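(* Let $\mathfrak G=(\mathfrak h\xrightarrow{t}\mathfrak g\xrightarrow{\alpha}\mathfrak{der}(\mathfrak h))$ be a central crossed module of Lie algebras with $\mathfrak a=\ker t$, $\mathfrak f=\mathfrak g/t(\mathfrak h)$, and let $s$ be a section of $\mathfrak G$. 1. The following are equivalent: (i) $\mathfrak G$ admits infinitesimal adjustments; (ii) $\mathfrak G$ admits infinitesimal adjustments adapted to $s$; (iii) the Kassel-Loday class $\mathrm{KL}(\mathfrak G)\in H^3(\mathfrak f,\mathfrak a)$ lies in the image of the Chern-Weil homomorphism $\mathrm{cw}:\mathrm{Sym}^2(\mathfrak f,\mathfrak a)^{\mathrm{ad}}\to H^3(\mathfrak f,\mathfrak a)$. 2. $\mathrm{Adj}(\mathfrak G)$ is a (possibly empty) affine space over $T(\mathfrak f,\mathfrak h)$, and $\mathrm{Adj}^s(\mathfrak G)$ is a (possibly empty) affine space over $T(\mathfrak f,\mathfrak a)$. 3. There is a canonical map $\mathrm{KL}^{\mathrm{adj}}:\mathrm{Adj}^s(\mathfrak G)\to\mathrm{Sym}^2(\mathfrak f,\mathfrak a)^{\mathrm{ad}}$, $\eta\mapsto\mathrm{KL}^{\mathrm{adj}}(\mathfrak G,\eta)$, the adjusted Kassel-Loday class, such that $[\mathrm{cw}(\mathrm{KL}^{\mathrm{adj}}(\mathfrak G,\eta))]=\mathrm{KL}(\mathfrak G)$ for every $\eta$. Its fibre over $B\in\mathrm{Sym}^2(\mathfrak f,\mathfrak a)^{\mathrm{ad}}$ is a (non-empty) affine space over $\mathrm{Alt}^2_{\mathrm{cl}}(\mathfrak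 f,\mathfrak a)\subset T(\mathfrak f,\mathfrak a)$ if $[\mathrm{cw}(B)]=\mathrm{KL}(\mathfrak G)$, and it is empty otherwise. 4. If $\mathfrak G$ is weakly equivalent to another central crossed module $\mathfrak G'$ of Lie algebras, and $s'$ is a section of $\mathfrak G'$, then there exists a bijection $\mathrm{Adj}^s(\mathfrak G)\cong\mathrm{Adj}^{s'}(\mathfrak G')$.
   Context: Lie algebras may be infinite-dimensional and carry locally convex topologies with continuous brackets and structure maps; all linear and multilinear maps are continuous. A crossed module of Lie algebras $\mathfrak G=(\mathfrak h\xrightarrow{t}\mathfrak g\xrightarrow{\alpha}\mathfrak{der}(\mathfrak h))$ consists of Lie algebras $\mathfrak g,\mathfrak h$, a Lie algebra homomorphism $t$, and an action $\alpha:\mathfrak g\times\mathfrak h\to\mathfrak h$ by derivations with $t(\alpha(X,y))=[X,t(y)]$ and $\alpha(t(x),y)=[x,y]$. It is central if $\alpha(X,y)=0$ for all $y\in\mathfrak a:=\ker t$. Put $\mathfrak f=\mathfrak g/t(\mathfrak h)$ with projection $p:\mathfrak g\to\mathfrak f$. Crossed modules are assumed smoothly separable: $\mathfrak a\subset\mathfrak h$ and $t(\mathfrak h)\subset\mathfrak g$ are complemented, so that continuous linear maps $u:\mathfrak g\to\mathfrak h$ with $tut=t$, $utu=u$ exist. A section is a linear $s:\mathfrak f\to\mathfrak g$ with $ps=\mathrm{id}$; $\rho_s:=\mathrm{id}-sp$. An infinitesimal adjustment on $\mathfrak G$ is a bilinear $\eta:\mathfrak g\times\mathfrak g\to\mathfrak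 h$ with $\eta([X,Y],Z)+\eta(Y,[X,Z])=\eta(X,[Y,Z])$, $\eta(t x,Y)=-\alpha(Y,x)$, $\eta(X,t y)=\alpha(X,y)$; it is adapted to $s$ if $t\eta(X,Y)=\rho_s([X,Y])$. $\mathrm{Adj}(\mathfrak G)\supset\mathrm{Adj}^s(\mathfrak G)$ are the sets of infinitesimal adjustments, resp. those adapted to $s$. $\mathrm{Alt}^k(\mathfrak g,V)$ is the space of $V$-valued alternating $k$-linear forms with differential $\delta\omega(X_1,\dots,X_{k+1})=\sum_{i<j}(-1)^{i+j}\omega([X_i,X_j],X_1,\dots,\widehat{X_i},\dots,\widehat{X_j},\dots,X_{k+1})$; the subscript cl denotes closed forms and $H^k(\mathfrak g,V)$ the cohomology. Kassel-Loday class: a half splitting is a linear $u:\mathfrak g\to\mathfrak h$ with $tut=t$. With $\rho=tu$, $\rho^\perp=\mathrm{id}-\rho$ put $\omega_u(X,Y)=\alpha(X,u(Y))-\alpha(Y,u(X))-[u(X),u(Y)]+u([\rho^\perp X,\rho^\perp Y])$. Then $\delta\omega_u=p^*C_u$ for a unique $C_u\in\mathrm{Alt}^3_{\mathrm{cl}}(\mathfrak f,\mathfrak a)$, and $\mathrm{KL}(\mathfrak G):=[C_u]\in H^3(\mathfrak f,\mathfrak a)$, independent of $u$. $T(\mathfrak f,V)$ is the vector space of bilinear $\eta:\mathfrak f\times\mathfrak f\to V$ with $\eta([X,Y],Z)+\eta(Y,[X,Z])=\eta(X,[Y,Z])$. $\mathrm{Sym}^2(\mathfrak f,\mathfrak a)^{\mathrm{ad}}$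 is the space of symmetric bilinear $B:\mathfrak f\times\mathfrak f\to\mathfrak a$ with $B([X,Y],Z)=B(X,[Y,Z])$, and $\mathrm{cw}(B)(X,Y,Z)=B([X,Y],Z)$, a closed 3-form; $\mathrm{cw}$ also denotes its class in cohomology. For $\eta\in\mathrm{Adj}^s(\mathfrak G)$, $\mathrm{KL}^{\mathrm{adj}}(\mathfrak G,\eta)$ is the unique $B\in\mathrm{Sym}^2(\mathfrak f,\mathfrak a)^{\mathrm{ad}}$ with $\tfrac12(\eta(X,Y)+\eta(Y,X))=-B(pX,pY)$. An affine space over a vector space $V$ is a set with a free and transitive action of $V$ (the empty set being allowed where stated); here $\beta$ acts by $\eta\mapsto\eta+p^*\beta$. A butterfly $\mathfrak k:\mathfrak G_1\to\mathfrak G_2$ is a Lie algebra $\mathfrak k$ with Lie algebra homomorphisms $i_1:\mathfrak h_1\to\mathfrak k$, $i_2:\mathfrak h_2\to\mathfrak k$, $r_1:\mathfrak k\to\mathfrak g_1$, $r_2:\mathfrak k\to\mathfrak g_2$ such that $r_1i_1=t_1$, $r_2i_2=t_2$, $r_2i_1=0$, $0\to\mathfrak h_2\xrightarrow{i_2}\mathfrak k\xrightarrow{r_1}\mathfrak g_1\to0$ is a (linearly split) short exact sequence, and $i_1(\alpha_1(r_1X,y_1))=[X,i_1y_1]$, $i_2(\alpha_2(r_2X,y_2))=[X,i_2y_2]$. It is invertible if $0\to\mathfrak h_1\xrightarrow{i_1}\mathfrak k\xrightarrow{r_2}\mathfrak g_2\to0$ is also exact. Two crossed modules are weakly equivalent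 if there is an invertible butterfly between them. *)

(* Defs.v *)
From HB Require Import structures.
From mathcomp Require Import all_boot all_order all_algebra.
From mathcomp Require Import generic_quotient ring_quotient sesquilinear.
From mathcomp Require Import all_classical all_reals all_analysis.

Set Implicit Arguments.
Unset Strict Implicit.
Unset Printing Implicit Defensive.
Import Order.TTheory GRing.Theory Num.Theory.
Local Open Scope classical_set_scope.
Local Open Scope ring_scope.

Section ContinuousMultilinear.
Context {R : realType}.

Definition lin_cont (U V : tvsType R) (f : U -> V) : Prop :=
  linear f /\ continuous f.

Definition bilin_cont (U V W : tvsType R) (b : U -> V -> W) : Prop :=
  bilinear_for *:%R *:%R b /\ continuous (fun z : U * V => b z.1 z.2).

Definition trilin_cont (U V : tvsType R) (c : U -> U -> U -> V) : Prop :=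
  [/\ forall y z, linear (fun x => c x y z),
      forall x z, linear (fun y => c x y z),
      forall x y, linear (fun z => c x y z) &
      continuous (fun v : U * U * U => c v.1.1 v.1.2 v.2)].

(* Topological complement: A is the range of a continuous projection. *)
Definition complemented (V : tvsType R) (A : set V) : Prop :=
  exists P : V -> V,
    [/\ lin_cont P, forall x, A (P x) & forall x, A x -> P x = x].

(* Short exact sequence of topological vector spaces: besides algebraic
   exactness, i is a homeomorphism onto its image and r is open. *)
Definition short_exact (U V W : tvsType R) (i : U -> V) (r : V -> W) : Prop :=
  [/\ injective i, range i = [set x | r x = 0], range r = [set: W],
      forall A : set U, open A -> exists2 B, open B & A = i @^-1` B &
      forall A : set V, open A -> open (r @` A)].

End ContinuousMultilinear.

HB.mixin Record isTopologicalLie (R : realType) V & Tvs R V := {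
  lie_bracket : V -> V -> V;
  lie_bilin_cont : bilin_cont lie_bracket;
  lie_alternating : forall x, lie_bracket x x = 0;
  lie_jacobi : forall x y z, lie_bracket x (lie_bracket y z) +
    lie_bracket y (lie_bracket z x) + lie_bracket z (lie_bracket x y) = 0
}.

#[short(type="lieTvsType")]
HB.structure Definition LieTvs (R : realType) :=
  {V of isTopologicalLie R V & Tvs R V}.

Notation "[ 'Lie' x , y ]" := (lie_bracket x y)
  (at level 0, x, y at level 99, format "[ 'Lie'  x ,  y ]") : ring_scope.

Section LieTheory.
Context {R : realType} (g : lieTvsType R).
Implicit Types x y z : g.

Fact lie_linearl x : linear (lie_bracket^~ x).
Proof. by move=> *; exact: (@lie_bilin_cont R g).1.1. Qed.

Fact lie_linearr x : linear (lie_bracket x).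
Proof. by move=> *; exact: (@lie_bilin_cont R g).1.2. Qed.

Fact lieDl x y z : [Lie x + y, z] = [Lie x, z] + [Lie y, z].
Proof. by have := lie_linearl z 1 x y; rewrite !scale1r. Qed.

Fact lieDr x y z : [Lie x, y + z] = [Lie x, y] + [Lie x, z].
Proof. by have := lie_linearr x 1 y z; rewrite !scale1r. Qed.

Fact lieC x y : [Lie x, y] = - [Lie y, x].
Proof.
apply/eqP; rewrite -addr_eq0; apply/eqP.
have := lie_alternating (x + y).
by rewrite lieDl !lieDr !lie_alternating add0r addr0.
Qed.

End LieTheory.

Definition lie_hom (R : realType) (g h : lieTvsType R) (f : g -> h) : Prop :=
  lin_cont f /\ forall x y, f [Lie x, y] = [Lie f x, f y].

Record crossedModule (R : realType) := CrossedModule {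
  cm_h : lieTvsType R;
  cm_g : lieTvsType R;
  cm_t : cm_h -> cm_g;
  cm_act : cm_g -> cm_h -> cm_h;
  cm_t_hom : lie_hom cm_t;
  cm_act_bilin : bilin_cont cm_act;
  cm_act_lie : forall X Y z,
    cm_act [Lie X, Y] z = cm_act X (cm_act Y z) - cm_act Y (cm_act X z);
  cm_act_der : forall X y z,
    cm_act X [Lie y, z] = [Lie cm_act X y, z] + [Lie y, cm_act X z];
  cm_t_act : forall X y, cm_t (cm_act X y) = [Lie X, cm_t y];
  cm_act_t : forall x y, cm_act (cm_t x) y = [Lie x, y]
}.

Arguments cm_t {R} c.
Arguments cm_act {R} c.

(* The quotient Lie algebra f = g / t(h), with the quotient topology. *)
Section Cokernel.
Context {R : realType} (G : crossedModule R).
Local Notation g := (cm_g G).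
Local Notation h := (cm_h G).

Definition cm_im : {pred g} := fun X => `[< exists x, cm_t G x = X >].

Fact cm_imP X : reflect (exists x, cm_t G x = X) (X \in cm_im).
Proof. exact: asboolP. Qed.

Fact cm_t0 : cm_t G 0 = 0.
Proof. by have := (cm_t_hom G).1.1 (-1) 0 0; rewrite !scaleN1r !addNr. Qed.

Fact cm_tD a x y : cm_t G (a *: x + y) = a *: cm_t G x + cm_t G y.
Proof. exact: (cm_t_hom G).1.1. Qed.

Fact cm_im_zmod : zmod_closed cm_im.
Proof.
split; first by apply/cm_imP; exists 0; exact: cm_t0.
move=> _ _ /cm_imP[x <-] /cm_imP[y <-]; apply/cm_imP; exists ((-1) *: y + x).
by rewrite cm_tD scaleN1r addrC.
Qed.

HB.instance Definition _ := GRing.isZmodClosed.Build g cm_im cm_im_zmod.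

Definition cm_f : Type := Quotient.quot cm_im.
HB.instance Definition _ := GRing.Zmodule.on cm_f.
HB.instance Definition _ := Quotient.on cm_f.

Definition cm_p (X : g) : cm_f := (\pi_cm_f X)%qT.

Fact cm_p_surj z : cm_p (repr z) = z.
Proof. exact: reprK. Qed.

Fact cm_p_eq X Y : cm_p X = cm_p Y <-> exists x, cm_t G x = X - Y.
Proof.
split=> [/eqP|XY]; first by rewrite -Quotient.idealrBE => /cm_imP.
by apply/eqP; rewrite -Quotient.idealrBE; apply/cm_imP.
Qed.

Fact cm_pD X Y : cm_p (X + Y) = cm_p X + cm_p Y.
Proof. exact: Quotient.pi_add. Qed.

Definition cm_f_scale (a : R) (z : cm_f) : cm_f := cm_p (a *: repr z).

Fact cm_pZ a X : cm_p (a *: X) = cm_f_scale a (cm_p X).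
Proof.
have [x xE] := (cm_p_eq X (repr (cm_p X))).1 (esym (cm_p_surj _)).
by apply/cm_p_eq; exists (a *: x); rewrite -[LHS]addr0 -cm_t0 -scalerBr -xE
  -[a *: x]addr0 cm_tD !cm_t0 !addr0.
Qed.

Fact cm_f_scaleA a b z : cm_f_scale a (cm_f_scale b z) = cm_f_scale (a * b) z.
Proof. by rewrite -[z]cm_p_surj -!cm_pZ scalerA. Qed.

Fact cm_f_scale1 : left_id 1 cm_f_scale.
Proof. by move=> z; rewrite -[z]cm_p_surj -!cm_pZ scale1r. Qed.

Fact cm_f_scaleDr : right_distributive cm_f_scale +%R.
Proof.
move=> a z w; rewrite -[z]cm_p_surj -[w]cm_p_surj.
by rewrite -cm_pD -!cm_pZ -cm_pD scalerDr.
Qed.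

Fact cm_f_scaleDl z : {morph cm_f_scale^~ z : a b / a + b}.
Proof. by move=> a b; rewrite -[z]cm_p_surj -!cm_pZ scalerDl cm_pD. Qed.

HB.instance Definition _ := GRing.Zmodule_isLmodule.Build R cm_f
  cm_f_scaleA cm_f_scale1 cm_f_scaleDr cm_f_scaleDl.

Definition cm_f_open (U : set cm_f) : Prop := open (cm_p @^-1` U).

Fact cm_f_openT : cm_f_open setT.
Proof. by rewrite /cm_f_open preimage_setT; exact: openT. Qed.

Fact cm_f_openI : setI_closed cm_f_open.
Proof. by move=> ? ? ? ?; exact: openI. Qed.

Fact cm_f_open_bigcup (I : Type) (F : I -> set cm_f) :
  (forall i, cm_f_open (F i)) -> cm_f_open (\bigcup_i F i).
Proof. by move=> oF; apply: bigcup_open => i _; exact: oF. Qed.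

HB.instance Definition _ :=
  isOpenTopological.Build cm_f cm_f_openT cm_f_openI cm_f_open_bigcup.

Fact cm_p_linear : linear (cm_p : g -> cm_f).
Proof. by move=> a X Y; rewrite cm_pD cm_pZ. Qed.

Fact cm_p0 : cm_p 0 = 0.
Proof. by have := cm_pD 0 0; rewrite addr0 -[LHS]addr0 => /addrI. Qed.

Fact cm_p_continuous : continuous cm_p.
Proof. exact/continuousP. Qed.

Fact cm_p_open (A : set g) : open A -> open (cm_p @` A).
Proof.
move=> oA; suff -> : open (cm_p @` A) =
    open (\bigcup_x [set X | A (X + cm_t G x)]).
  apply: bigcup_open => x _.
  have /continuousP : continuous (fun X : g => X + cm_t G x).
    move=> X; apply: (@continuous_comp _ _ _ (fun X : g => (X, cm_t G x))
      (fun z : g * g => z.1 + z.2)); last exact: add_continuous.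
    by apply: cvg_pair; [exact: cvg_id|exact: cvg_cst].
  exact.
rewrite [LHS]/open/= /cm_f_open; congr open; apply/seteqP; split=> X /=.
  by case=> Y AY /cm_p_eq[x xE]; exists x => //=; rewrite xE addrC subrK.
case=> x _ /= AX; exists (X + cm_t G x) => //.
by apply/cm_p_eq; exists x; rewrite addrAC subrr add0r.
Qed.

Fact cm_p_nbhs X (A : set g) : nbhs X A -> nbhs (cm_p X) (cm_p @` A).
Proof.
rewrite nbhsE => -[B [oB BX] BA]; rewrite nbhsE.
exists (cm_p @` B); last exact: image_subset.
by split; [exact: cm_p_open|exists X].
Qed.

Fact cm_f_add_continuous : continuous (fun z : cm_f * cm_f => z.1 + z.2).
Proof.
move=> [z w] U; rewrite /= -(cm_p_surj z) -(cm_p_surj w) -cm_pD.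
move=> /cm_p_continuous /(@add_continuous g (repr z, repr w))[[A B]].
move=> /= [nA nB] AB.
exists (cm_p @` A, cm_p @` B); first by split; exact: cm_p_nbhs.
move=> [_ _] /= [[X AX <-] [Y BY <-]]; rewrite -cm_pD.
exact: (AB (X, Y)).
Qed.

Fact cm_f_scale_continuous : continuous (fun z : R^o * cm_f => z.1 *: z.2).
Proof.
move=> [a z] U; rewrite /= -(cm_p_surj z) -[a *: _]cm_pZ.
move=> /cm_p_continuous /(@scale_continuous R g (a, repr z))[[A B]].
move=> /= [nA nB] AB; exists (A, cm_p @` B); first by split=> //; exact: cm_p_nbhs.
by move=> [b _] /= [Ab [Y BY <-]]; rewrite -[b *: _]cm_pZ; exact: (AB (b, Y)).
Qed.

Fact cm_f_locally_convex : exists2 B : set_system cm_f,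
  (forall b, b \in B -> convex_set b) & basis B.
Proof.
have [B convB [oB basB]] := @locally_convex R g.
exists [set cm_p @` b | b in B].
  move=> _ /set_mem[b Bb <-]; move=> z w l.
  move=> /set_mem[X bX <-] /set_mem[Y bY <-]; apply/mem_set.
  have /set_mem bXY := convB b (mem_set Bb) X Y l (mem_set bX) (mem_set bY).
  exists (conv l (X : convex_lmodType g) (Y : convex_lmodType g)) => //.
  by rewrite /conv/= cm_pD !cm_pZ.
split=> [_ [b Bb <-]|z U]; first exact/cm_p_open/oB.
rewrite -(cm_p_surj z) => /cm_p_continuous /basB[b [Bb bz] bU].
exists (cm_p @` b) => [/=|w [X bX <-]]; last exact: bU.
by split; [exists b|exists (repr z)].
Qed.

(* The factory only provides the uniform structure. *)
HB.instance Definition _ := PreTopologicalLmod_isTvs.Build R cm_f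
  cm_f_add_continuous cm_f_scale_continuous cm_f_locally_convex.
HB.instance Definition _ :=
  PreTopologicalNmodule_isTopologicalNmodule.Build cm_f cm_f_add_continuous.
HB.instance Definition _ :=
  TopologicalNmodule_isTopologicalLmodule.Build R cm_f cm_f_scale_continuous.
HB.instance Definition _ :=
  Uniform_isTvs.Build R cm_f cm_f_locally_convex.

Definition cm_f_bracket (z w : cm_f) : cm_f := cm_p [Lie repr z, repr w].

Fact cm_f_bracketE X Y : cm_f_bracket (cm_p X) (cm_p Y) = cm_p [Lie X, Y].
Proof.
have /cm_p_eq[x xE] := cm_p_surj (cm_p X).
have /cm_p_eq[y yE] := cm_p_surj (cm_p Y).
rewrite /cm_f_bracket -[repr (cm_p X)](subrK X) -[repr (cm_p Y)](subrK Y).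
rewrite -xE -yE; apply/cm_p_eq.
exists (- cm_act G (cm_t G y + Y) x + cm_act G X y).
rewrite -scaleN1r cm_tD !cm_t_act scaleN1r -[- [Lie _ + Y, _]]lieC (lieDl _ X) (lieDr X).
by rewrite addrA addrK.
Qed.

Fact cm_f_bilin_cont : bilin_cont cm_f_bracket.
Proof.
split; first split=> [w a z z'|z a w w'].
- rewrite -(cm_p_surj w) -(cm_p_surj z) -(cm_p_surj z') -cm_p_linear.
  by rewrite !cm_f_bracketE lie_linearl cm_p_linear.
- rewrite -(cm_p_surj w) -(cm_p_surj z) -(cm_p_surj w') -cm_p_linear.
  by rewrite !cm_f_bracketE lie_linearr cm_p_linear.
move=> [z w] U; rewrite /= -(cm_p_surj z) -(cm_p_surj w) cm_f_bracketE.
move=> /cm_p_continuous /((@lie_bilin_cont R g).2 (repr z, repr w))[[A B]].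
move=> /= [nA nB] AB.
exists (cm_p @` A, cm_p @` B); first by split; exact: cm_p_nbhs.
move=> [_ _] /= [[X AX <-] [Y BY <-]]; rewrite cm_f_bracketE.
exact: (AB (X, Y)).
Qed.

Fact cm_f_alternating z : cm_f_bracket z z = 0.
Proof.
by rewrite -(cm_p_surj z) cm_f_bracketE lie_alternating cm_p0.
Qed.

Fact cm_f_jacobi x y z : cm_f_bracket x (cm_f_bracket y z) +
  cm_f_bracket y (cm_f_bracket z x) + cm_f_bracket z (cm_f_bracket x y) = 0.
Proof.
rewrite -(cm_p_surj x) -(cm_p_surj y) -(cm_p_surj z) !cm_f_bracketE -!cm_pD.
by rewrite lie_jacobi cm_p0.
Qed.

HB.instance Definition _ := isTopologicalLie.Build R cm_f
  cm_f_bilin_cont cm_f_alternating cm_f_jacobi.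

End Cokernel.

Section Forms.
Context {R : realType} (f : lieTvsType R) (W : tvsType R) (V : set W).

(* V is a linear subspace of W with the induced topology: V-valued continuous
   maps are continuous maps to W with values in V.  The differential delta is
   spelled out in degrees 2 and 3. *)

Definition Alt2 : set (f -> f -> W) :=
  [set w | [/\ bilin_cont w, forall X Y, V (w X Y) & forall X, w X X = 0]].

Definition Alt3 : set (f -> f -> f -> W) :=
  [set c | [/\ trilin_cont c, forall X Y Z, V (c X Y Z) &
    forall X Y, [/\ c X X Y = 0, c X Y X = 0 & c Y X X = 0]]].

Definition delta2 (w : f -> f -> W) : f -> f -> f -> W := fun X1 X2 X3 =>
  - w [Lie X1, X2] X3 + w [Lie X1, X3] X2 - w [Lie X2, X3] X1.

Definition delta3 (c : f -> f -> f -> W) : f -> f -> f -> f -> W :=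
  fun X1 X2 X3 X4 =>
  - c [Lie X1, X2] X3 X4 + c [Lie X1, X3] X2 X4 - c [Lie X1, X4] X2 X3
  - c [Lie X2, X3] X1 X4 + c [Lie X2, X4] X1 X3 - c [Lie X3, X4] X1 X2.

Definition Alt2_cl : set (f -> f -> W) := [set w | Alt2 w /\ delta2 w = 0].

Definition Alt3_cl : set (f -> f -> f -> W) := [set c | Alt3 c /\ delta3 c = 0].

(* Elements of H^3(f, V) are the cosets c + delta (Alt^2(f, V)) of closed
   3-forms c. *)
Definition class3 (c : f -> f -> f -> W) : set (f -> f -> f -> W) :=
  [set c' | exists2 w, Alt2 w & c' = c + delta2 w].

Definition H3 : set (set (f -> f -> f -> W)) := class3 @` Alt3_cl.

Definition Tspace : set (f -> f -> W) :=
  [set b | [/\ bilin_cont b, forall X Y, V (b X Y) &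
    forall X Y Z, b [Lie X, Y] Z + b Y [Lie X, Z] = b X [Lie Y, Z]]].

Definition Sym2_ad : set (f -> f -> W) :=
  [set B | [/\ bilin_cont B, forall X Y, V (B X Y), forall X Y, B X Y = B Y X &
    forall X Y Z, B [Lie X, Y] Z = B X [Lie Y, Z]]].

Definition cw (B : f -> f -> W) : f -> f -> f -> W :=
  fun X Y Z => B [Lie X, Y] Z.

End Forms.

Arguments Alt2 {R} f {W} V.
Arguments Alt3 {R} f {W} V.
Arguments Alt2_cl {R} f {W} V.
Arguments Alt3_cl {R} f {W} V.
Arguments H3 {R} f {W} V.
Arguments Tspace {R} f {W} V.
Arguments Sym2_ad {R} f {W} V.
Arguments class3 {R f W} V c.
Arguments delta2 {R f W}.
Arguments delta3 {R f W}.
Arguments cw {R f W}.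

(* S is a possibly empty affine space over V, with v acting on x by act x v. *)
Definition affine_over (R : realType) (D : lmodType R) (V : set D)
    (E : Type) (S : set E) (act : E -> D -> E) : Prop :=
  [/\ V 0 /\ forall (a : R) v w, V v -> V w -> V (a *: v + w),
      forall x v, S x -> V v -> S (act x v),
      (forall x, S x -> act x 0 = x) /\
      (forall x v w, S x -> V v -> V w -> act x (v + w) = act (act x v) w),
      forall x v, S x -> V v -> act x v = x -> v = 0 &
      forall x y, S x -> S y -> exists2 v, V v & act x v = y].

Section CrossedModuleTheory.
Context {R : realType} (G : crossedModule R).
Local Notation g := (cm_g G).
Local Notation h := (cm_h G).
Local Notation f := (cm_f G).
Local Notation t := (cm_t G).
Local Notation alpha := (cm_act G).
Local Notation p := (@cm_p R G).

Definition cm_a : set h := [set y | t y = 0].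

Definition central : Prop := forall X y, cm_a y -> alpha X y = 0.

Definition smoothly_separable : Prop :=
  [/\ complemented cm_a, complemented (range t) &
      exists u : g -> h, [/\ lin_cont u, forall x, t (u (t x)) = t x &
        forall X, u (t (u X)) = u X]].

Definition cm_section (s : f -> g) : Prop := lin_cont s /\ forall z, p (s z) = z.

Definition rho (s : f -> g) (X : g) : g := X - s (p X).

Definition Adj : set (g -> g -> h) :=
  [set eta | [/\ bilin_cont eta,
    forall X Y Z, eta [Lie X, Y] Z + eta Y [Lie X, Z] = eta X [Lie Y, Z],
    forall x Y, eta (t x) Y = - alpha Y x &
    forall X y, eta X (t y) = alpha X y]].

Definition Adj_at (s : f -> g) : set (g -> g -> h) :=
  [set eta | Adj eta /\ forall X Y, t (eta X Y) = rho s [Lie X, Y]].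

Definition pull2 (b : f -> f -> h) : g -> g -> h := fun X Y => b (p X) (p Y).

Definition pull3 (c : f -> f -> f -> h) : g -> g -> g -> h :=
  fun X Y Z => c (p X) (p Y) (p Z).

Definition adj_shift (eta : g -> g -> h) (b : f -> f -> h) : g -> g -> h :=
  eta + pull2 b.

Definition half_splitting (u : g -> h) : Prop :=
  lin_cont u /\ forall x, t (u (t x)) = t x.

Definition KL_omega (u : g -> h) : g -> g -> h := fun X Y =>
  let rho_perp Z := Z - t (u Z) in
  alpha X (u Y) - alpha Y (u X) - [Lie u X, u Y]
    + u [Lie rho_perp X, rho_perp Y].

(* The unique C_u in Alt^3_cl(f, a) with delta omega_u = p^* C_u. *)
Definition KL_form (u : g -> h) : f -> f -> f -> h :=
  xget 0 [set C | Alt3_cl f cm_a C /\ delta2 (KL_omega u) = pull3 C].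

(* The element of H^3(f, a) that equals [C_u] for every half splitting u. *)
Definition KL : set (f -> f -> f -> h) :=
  xget set0 [set c | H3 f cm_a c /\
    forall u, half_splitting u -> c = class3 cm_a (KL_form u)].

(* The unique B with (eta(X, Y) + eta(Y, X)) / 2 = - B(pX, pY). *)
Definition KL_adj (eta : g -> g -> h) : f -> f -> h :=
  xget 0 [set B | Sym2_ad f cm_a B /\
    forall X Y, 2^-1 *: (eta X Y + eta Y X) = - B (p X) (p Y)].

End CrossedModuleTheory.

Arguments cm_a {R} G.
Arguments Adj {R} G.
Arguments Adj_at {R} G s.
Arguments KL {R} G.

Record butterfly (R : realType) (G1 G2 : crossedModule R) := Butterfly {
  bf_k : lieTvsType R;
  bf_i1 : cm_h G1 -> bf_k;
  bf_i2 : cm_h G2 -> bf_k;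
  bf_r1 : bf_k -> cm_g G1;
  bf_r2 : bf_k -> cm_g G2;
  bf_i1_hom : lie_hom bf_i1;
  bf_i2_hom : lie_hom bf_i2;
  bf_r1_hom : lie_hom bf_r1;
  bf_r2_hom : lie_hom bf_r2;
  bf_r1i1 : forall x, bf_r1 (bf_i1 x) = cm_t G1 x;
  bf_r2i2 : forall x, bf_r2 (bf_i2 x) = cm_t G2 x;
  bf_r2i1 : forall x, bf_r2 (bf_i1 x) = 0;
  bf_exact : short_exact bf_i2 bf_r1;
  bf_split : exists q, lin_cont q /\ forall X, bf_r1 (q X) = X;
  bf_act1 : forall X y, bf_i1 (cm_act G1 (bf_r1 X) y) = [Lie X, bf_i1 y];
  bf_act2 : forall X y, bf_i2 (cm_act G2 (bf_r2 X) y) = [Lie X, bf_i2 y]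
}.

Arguments bf_i1 {R G1 G2} b.
Arguments bf_r2 {R G1 G2} b.

Definition bf_invertible (R : realType) (G1 G2 : crossedModule R)
    (k : butterfly G1 G2) : Prop := short_exact (bf_i1 k) (bf_r2 k).

Definition weakly_equivalent (R : realType) (G1 G2 : crossedModule R) : Prop :=
  exists k : butterfly G1 G2, bf_invertible k.

(* Main.v *)
Require Import Defs.
From mathcomp Require Import all_boot all_order all_algebra.
From mathcomp Require Import all_classical all_reals all_analysis.
Import GRing.Theory Num.Theory.
Local Open Scope classical_set_scope.
Local Open Scope ring_scope.

Set Implicit Arguments.
Unset Strict Implicit.
Unset Printing Implicit Defensive.

(** Why the theorem holds. Fix a section [s]. An adjustment [eta] adapted to [s]
    splits into its symmetric part, which vanishes on [t h] and is therefore the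
    pullback of some [- B] with [B] valued in [a], and its skew part [b].
    The Leibniz identity of [eta] makes [B] ad-invariant
    ([adj_sym_invariant]) and, given that, says exactly
    [delta b = p^* (cw B)] ([adj_at_skew_lift], [skew_lift_adj_at]).

    The skew part satisfies [b (t x) Y = - alpha Y x] and
    [t (b X Y) = rho s [X, Y]]; an alternating form with these two properties is
    called a skew lift below. The form [KL_omega u] is a skew lift for the
    section that [u] determines, two skew lifts for [s] differ by the pullback of
    an element of [Alt^2(f, a)] ([skew_lift_diff]), and a change of section can be
    absorbed without changing the differential ([skew_lift_section]). So [KL] is
    the class of the form [C] with [delta b = p^* C] for any skew lift [b]
    ([KL_skew_lift]). Hence an adapted adjustment with symmetric part [- B]
    exists iff [cw B] represents [KL], which gives both the equivalence with the
    Chern-Weil condition and the description of the fibres; the fibres are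
    affine over closed forms because on alternating forms the Leibniz identity is
    closedness ([Tspace_Alt2]). An arbitrary adjustment is made adapted by adding
    the image under [u] of its defect ([adj_adapt]), and differences of
    adjustments vanish on [t h], whence the affine structures.

    For weakly equivalent crossed modules, an invertible butterfly [k] identifies
    the quotients [f], both being [k / (i1 h1 + i2 h2)] ([bf_quotient_map]), and
    the kernels [a], both being [i1 h1] intersected with [i2 h2]
    ([bf_kernel_map]). Thus the two spaces [T(f, a)] are in bijection, and it
    remains to see that one set of adjustments is nonempty when the other is. An
    adjustment is carried across [k] by an explicit formula ([bf_adj]); the
    converse direction follows because the butterfly can be reversed, once [r2]
    is shown to split ([bf_split_inv]). *)

(** * Deciding identities in abelian groups *)

(** Sums of signed atoms are compared through their integer coefficients: in a
    module there is no multiplication for a ring normalizer to work with. *)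
Inductive zexpr :=
  ZVar of nat | ZZero | ZAdd of zexpr & zexpr | ZOpp of zexpr.

Fixpoint zval (V : zmodType) (e : seq V) (t : zexpr) : V :=
  match t with
  | ZVar n => e`_n
  | ZZero => 0
  | ZAdd t1 t2 => zval e t1 + zval e t2
  | ZOpp t1 => - zval e t1
  end.

Fixpoint zcoef (t : zexpr) (i : nat) : int :=
  match t with
  | ZVar n => (n == i)%:Z
  | ZZero => 0
  | ZAdd t1 t2 => zcoef t1 i + zcoef t2 i
  | ZOpp t1 => - zcoef t1 i
  end.

Lemma zvalE (V : zmodType) (e : seq V) t :
  zval e t = \sum_(i < size e) e`_i *~ zcoef t i.
Proof.
elim: t => [n||t1 IH1 t2 IH2|t1 IH1] /=.
- have [lt_n|le_n] := ltnP n (size e).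
    rewrite (bigD1 (Ordinal lt_n)) //= eqxx big1 ?addr0// => i.
    by rewrite -val_eqE /= eq_sym => /negPf ->.
  rewrite nth_default // big1// => i _.
  by rewrite gtn_eqF // (leq_trans (ltn_ord i)).
- by rewrite big1// => i _; rewrite mulr0z.
- by rewrite IH1 IH2 -big_split; apply: eq_bigr => i _; rewrite mulrzDr.
- by rewrite IH1 -sumrN; apply: eq_bigr => i _; rewrite mulrNz.
Qed.

Lemma zmod_eq (V : zmodType) (e : seq V) t1 t2 :
  all (fun i => zcoef t1 i == zcoef t2 i) (iota 0 (size e)) ->
  zval e t1 = zval e t2.
Proof.
move=> /allP eq12; rewrite !zvalE; apply: eq_bigr => i _.
have /eq12/eqP -> // : (i : nat) \in iota 0 (size e) by rewrite mem_iota /=.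
Qed.

(* Atoms are compared up to unification, since one and the same scaling may
   occur through syntactically different structure instances. *)
Ltac zindex x l :=
  match l with
  | cons ?y _ => let _ := match goal with _ => unify x y end in constr:(0%N)
  | cons _ ?l' => let n := zindex x l' in constr:(S n)
  end.

Ltac zatoms l t :=
  lazymatch t with
  | ?a + ?b => let l' := zatoms l a in zatoms l' b
  | - ?a => zatoms l a
  | 0 => l
  (* the first branch fails when [t] is a new atom *)
  | _ => match l with
         | _ => let n := zindex t l in l
         | _ => constr:(cons t l)
         end
  end.

Ltac zreify l t :=
  lazymatch t with
  | ?a + ?b => let a' := zreify l a in let b' := zreify l b in
               constr:(ZAdd a' b')
  | - ?a => let a' := zreify l a in constr:(ZOpp a')
  | 0 => constr:(ZZero)
  | _ => let n := zindex t l in constr:(ZVar n)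
  end.

Ltac zmod :=
  lazymatch goal with
  | |- @eq ?T ?a ?b =>
      let l := zatoms (@nil T) a in
      let l := zatoms l b in
      let a' := zreify l a in
      let b' := zreify l b in
      exact (@zmod_eq _ l a' b' isT)
  end.

(** Reduces an equation that follows from the known one [a = b] to an identity
    that [zmod] can decide. *)
Lemma eq_from_sub (V : zmodType) (x y a b : V) :
  a = b -> x - y = a - b -> x = y.
Proof. by move=> ->; rewrite subrr => /eqP; rewrite subr_eq0 => /eqP. Qed.

(** * Continuous multilinear maps *)

Lemma cts_pair (T U V : topologicalType) (f : T -> U) (g : T -> V) :
  continuous f -> continuous g -> continuous (fun x => (f x, g x)).
Proof. by move=> cf cg x; apply: cvg_pair; [exact: cf|exact: cg]. Qed.

Lemma cts_comp (T U V : topologicalType) (g : U -> V) (f : T -> U) :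
  continuous g -> continuous f -> continuous (fun x => g (f x)).
Proof. by move=> cg cf x; apply: continuous_comp; [exact: cf|exact: cg]. Qed.

Lemma cts_fst (U V : topologicalType) : continuous (fst : U * V -> U).
Proof. by move=> x; exact: cvg_fst. Qed.

Lemma cts_snd (U V : topologicalType) : continuous (snd : U * V -> V).
Proof. by move=> x; exact: cvg_snd. Qed.

Section Calculus.
Context {R : realType}.
Implicit Types U V W E : tvsType R.

Lemma cts_add (T : topologicalType) V (f g : T -> V) :
  continuous f -> continuous g -> continuous (fun x => f x + g x).
Proof.
move=> cf cg; apply: (cts_comp (@add_continuous V) (f := fun x => (f x, g x))).
exact: cts_pair.
Qed.

Lemma cts_scale (T : topologicalType) V (a : R) (f : T -> V) :
  continuous f -> continuous (fun x => a *: f x).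
Proof.
move=> cf; apply: (cts_comp (@scale_continuous R V)
  (f := fun x => (a : R^o, f x))).
by apply: cts_pair => //; move=> x; exact: cvg_cst.
Qed.

Lemma cts_opp (T : topologicalType) V (f : T -> V) :
  continuous f -> continuous (fun x => - f x).
Proof.
have -> : (fun x => - f x) = (fun x => -1 *: f x).
  by apply/funext => x; rewrite scaleN1r.
exact: cts_scale.
Qed.

Lemma linearMD U V (f : U -> V) : linear f -> {morph f : x y / x + y}.
Proof. by move=> lf x y; have := lf 1 x y; rewrite !scale1r. Qed.

Lemma linearM0 U V (f : U -> V) : linear f -> f 0 = 0.
Proof.
by move=> lf; have := linearMD lf 0 0; rewrite addr0 -[LHS]addr0 => /addrI.
Qed.

Lemma linearMZ U V (f : U -> V) a : linear f -> {morph f : x / a *: x}.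
Proof. by move=> lf x; have := lf a x 0; rewrite (linearM0 lf) !addr0. Qed.

Lemma linearMN U V (f : U -> V) : linear f -> {morph f : x / - x}.
Proof. by move=> lf x; rewrite -(scaleN1r x) (linearMZ _ lf) scaleN1r. Qed.

Section Linear.
Context {U V : tvsType R} (f : U -> V) (hf : lin_cont f).

Lemma lcD : {morph f : x y / x + y}. Proof. exact: linearMD hf.1. Qed.
Lemma lc0 : f 0 = 0. Proof. exact: linearM0 hf.1. Qed.
Lemma lcZ a : {morph f : x / a *: x}. Proof. exact: linearMZ hf.1. Qed.
Lemma lcN : {morph f : x / - x}. Proof. exact: linearMN hf.1. Qed.

End Linear.

Section Bilinear.
Context {U V W : tvsType R} (b : U -> V -> W) (hb : bilin_cont b).
Implicit Types (x y : U) (z w : V).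

Lemma bc_linl z : linear (b^~ z). Proof. by move=> *; exact: hb.1.1. Qed.
Lemma bc_linr x : linear (b x). Proof. by move=> *; exact: hb.1.2. Qed.
Lemma bcDl x y z : b (x + y) z = b x z + b y z.
Proof. exact: (linearMD (bc_linl z)). Qed.
Lemma bcDr x z w : b x (z + w) = b x z + b x w.
Proof. exact: (linearMD (bc_linr x)). Qed.
Lemma bcNl x z : b (- x) z = - b x z.
Proof. exact: (linearMN (bc_linl z)). Qed.
Lemma bcNr x z : b x (- z) = - b x z.
Proof. exact: (linearMN (bc_linr x)). Qed.
Lemma bc0l z : b 0 z = 0. Proof. exact: (linearM0 (bc_linl z)). Qed.
Lemma bc0r x : b x 0 = 0. Proof. exact: (linearM0 (bc_linr x)). Qed.

End Bilinear.

Lemma lin_cont_id V : lin_cont (fun x : V => x).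
Proof. by split => // x; exact: cvg_id. Qed.

Lemma lin_cont_comp U V W (g : V -> W) (f : U -> V) :
  lin_cont g -> lin_cont f -> lin_cont (fun x => g (f x)).
Proof.
move=> [lg cg] [lf cf]; split; last exact: cts_comp.
by move=> a x y; rewrite lf lg.
Qed.

Lemma lin_contD U V (f g : U -> V) :
  lin_cont f -> lin_cont g -> lin_cont (fun x => f x + g x).
Proof.
move=> [lf cf] [lg cg]; split; last exact: cts_add.
by move=> a x y; rewrite lf lg scalerDr; zmod.
Qed.

Lemma lin_contN U V (f : U -> V) : lin_cont f -> lin_cont (fun x => - f x).
Proof.
move=> [lf cf]; split; last exact: cts_opp.
by move=> a x y; rewrite lf scalerN; zmod.
Qed.

Lemma bilin_cont0 U V W : bilin_cont (0 : U -> V -> W).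
Proof.
split; first by split=> [x a y z|x a y z]; rewrite /= scaler0 addr0.
by move=> z; exact: cvg_cst.
Qed.

Lemma bilin_contD U V W (b c : U -> V -> W) :
  bilin_cont b -> bilin_cont c -> bilin_cont (fun x y => b x y + c x y).
Proof.
move=> hb hc; split; last exact: (cts_add hb.2 hc.2).
split=> [z a x y|x a y z] /=.
- by rewrite (bc_linl hb z) (bc_linl hc z) scalerDr; zmod.
- by rewrite (bc_linr hb x) (bc_linr hc x) scalerDr; zmod.
Qed.

Lemma bilin_contZ U V W a (b : U -> V -> W) :
  bilin_cont b -> bilin_cont (fun x y => a *: b x y).
Proof.
move=> hb; split; last exact: (cts_scale (a := a) hb.2).
split=> [z c x y|x c y z] /=.
- by rewrite (bc_linl hb z) scalerDr !scalerA mulrC.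
- by rewrite (bc_linr hb x) scalerDr !scalerA mulrC.
Qed.

Lemma bilin_contN U V W (b : U -> V -> W) :
  bilin_cont b -> bilin_cont (fun x y => - b x y).
Proof.
have -> : (fun x y => - b x y) = (fun x y => -1 *: b x y).
  by apply/funext => x; apply/funext => y; rewrite scaleN1r.
exact: bilin_contZ.
Qed.

Lemma bilin_cont_flip U V W (b : U -> V -> W) :
  bilin_cont b -> bilin_cont (fun y x => b x y).
Proof.
move=> hb; split; first by split=> *; [exact: hb.1.2|exact: hb.1.1].
apply: (cts_comp hb.2 (f := fun z : V * U => (z.2, z.1))).
by apply: cts_pair; [exact: cts_snd|exact: cts_fst].
Qed.

Lemma bilin_cont_post U V W E (f : W -> E) (b : U -> V -> W) :
  lin_cont f -> bilin_cont b -> bilin_cont (fun x y => f (b x y)).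
Proof.
move=> hf hb; split; last exact: cts_comp hf.2 hb.2.
by split=> [z a x y|x a y z] /=; rewrite ?(bc_linl hb z) ?(bc_linr hb x) hf.1.
Qed.

Lemma bilin_cont_pre U V U' V' W (f : U' -> U) (g : V' -> V) (b : U -> V -> W) :
  lin_cont f -> lin_cont g -> bilin_cont b ->
  bilin_cont (fun x y => b (f x) (g y)).
Proof.
move=> hf hg hb; split; last first.
  apply: (cts_comp hb.2 (f := fun z : U' * V' => (f z.1, g z.2))).
  apply: cts_pair; first exact: (cts_comp hf.2 (@cts_fst _ _)).
  exact: (cts_comp hg.2 (@cts_snd _ _)).
split=> [z a x y|x a y z] /=.
- by rewrite hf.1 (bc_linl hb).
- by rewrite hg.1 (bc_linr hb).
Qed.

Lemma trilin_contD U V (b c : U -> U -> U -> V) :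
  trilin_cont b -> trilin_cont c ->
  trilin_cont (fun x y z => b x y z + c x y z).
Proof.
move=> [b1 b2 b3 cb] [c1 c2 c3 cc]; split; last exact: (cts_add cb cc).
- by move=> y z a x x'; rewrite b1 c1 scalerDr; zmod.
- by move=> x z a y y'; rewrite b2 c2 scalerDr; zmod.
- by move=> x y a z z'; rewrite b3 c3 scalerDr; zmod.
Qed.

Lemma trilin_contN U V (b : U -> U -> U -> V) :
  trilin_cont b -> trilin_cont (fun x y z => - b x y z).
Proof.
move=> [b1 b2 b3 cb]; split; last exact: (cts_opp cb).
- by move=> y z a x x'; rewrite b1 scalerN; zmod.
- by move=> x z a y y'; rewrite b2 scalerN; zmod.
- by move=> x y a z z'; rewrite b3 scalerN; zmod.
Qed.

Lemma trilin_cont_comp2 U V W (b : V -> U -> W) (c : U -> U -> V) :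
  bilin_cont b -> bilin_cont c -> trilin_cont (fun x y z => b (c x y) z).
Proof.
move=> hb hc; split.
- by move=> y z a x x'; rewrite (bc_linl hc y) (bc_linl hb z).
- by move=> x z a y y'; rewrite (bc_linr hc x) (bc_linl hb z).
- by move=> x y; exact: bc_linr hb _.
- apply: (cts_comp hb.2 (f := fun v : U * U * U => (c v.1.1 v.1.2, v.2))).
  apply: cts_pair; last exact: cts_snd.
  exact: (cts_comp hc.2 (@cts_fst _ _)).
Qed.

Lemma trilin_cont_swap U V (c : U -> U -> U -> V) :
  trilin_cont c -> trilin_cont (fun x y z => c x z y).
Proof.
move=> [c1 c2 c3 cc]; split=> //.
apply: (cts_comp cc (f := fun v : U * U * U => (v.1.1, v.2, v.1.2))).
have c_1 : continuous (fun v : U * U * U => v.1) := @cts_fst _ _.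
have c_11 := cts_comp (@cts_fst _ _) c_1.
have c_12 := cts_comp (@cts_snd _ _) c_1.
by do 2?apply: cts_pair => //; exact: cts_snd.
Qed.

Lemma trilin_cont_rot U V (c : U -> U -> U -> V) :
  trilin_cont c -> trilin_cont (fun x y z => c y z x).
Proof.
move=> [c1 c2 c3 cc]; split=> //.
apply: (cts_comp cc (f := fun v : U * U * U => (v.1.2, v.2, v.1.1))).
have c_1 : continuous (fun v : U * U * U => v.1) := @cts_fst _ _.
have c_11 := cts_comp (@cts_fst _ _) c_1.
have c_12 := cts_comp (@cts_snd _ _) c_1.
by do 2?apply: cts_pair => //; exact: cts_snd.
Qed.

Lemma trilin_cont_pre U U' V (f : U' -> U) (c : U -> U -> U -> V) :
  lin_cont f -> trilin_cont c -> trilin_cont (fun x y z => c (f x) (f y) (f z)).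
Proof.
move=> [lf cf] [c1 c2 c3 cc]; split.
- by move=> y z a x x'; rewrite lf c1.
- by move=> x z a y y'; rewrite lf c2.
- by move=> x y a z z'; rewrite lf c3.
apply: (cts_comp cc (f := fun v : U' * U' * U' => (f v.1.1, f v.1.2, f v.2))).
have c_1 : continuous (fun v : U' * U' * U' => v.1) := @cts_fst _ _.
have c_11 := cts_comp (@cts_fst _ _) c_1.
have c_12 := cts_comp (@cts_snd _ _) c_1.
by do 2?apply: cts_pair => //; apply: (cts_comp cf) => //; exact: cts_snd.
Qed.

(** The preimage of an open set under the induced map is the image under [q] of
    its preimage under [f], so openness of [q] gives continuity. *)
Lemma open_descent U V W (q : U -> V) (f : U -> W) :
  lin_cont q -> lin_cont f -> range q = setT ->
  (forall A : set U, open A -> open (q @` A)) ->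
  (forall x, q x = 0 -> f x = 0) ->
  exists2 g : V -> W, lin_cont g & forall x, g (q x) = f x.
Proof.
move=> hq hf qT qo kqf.
have rq y : exists x, q x = y.
  by have : range q y by [rewrite qT]; case=> x _ <-; exists x.
pose g y := f (xget 0 [set x | q x = y]).
have gq x : g (q x) = f x.
  have /= e := xgetPex 0 (rq (q x)).
  apply/eqP; rewrite -subr_eq0 -(lcN hf) -(lcD hf); apply/eqP/kqf.
  by rewrite (lcD hq) (lcN hq) e subrr.
exists g => //; split.
  move=> a y y'; have [x <-] := rq y; have [x' <-] := rq y'.
  by rewrite -hq.1 !gq hf.1.
apply/continuousP => A oA.
have -> : g @^-1` A = q @` (f @^-1` A).
  apply/seteqP; split=> [y|_ [x + <-]] /=; last by rewrite gq.
  by have [x <-] := rq y; rewrite gq => ?; exists x.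
by apply: qo; move/continuousP : hf.2; exact.
Qed.

(** The projection [1 - q r] has image [range i], and [i] is a homeomorphism onto
    its image, so the projection is still continuous when regarded as a map to
    [U]. *)
Lemma split_exact_retraction U V W (i : U -> V) (r : V -> W) (q : W -> V) :
  lin_cont i -> lin_cont r -> short_exact i r ->
  lin_cont q -> (forall z, r (q z) = z) ->
  exists j : V -> U, [/\ lin_cont j, forall x, j (i x) = x &
    forall y, i (j y) = y - q (r y)].
Proof.
move=> hi hr [inji imi rT oi _] hq rq.
have hP : lin_cont (fun y => y - q (r y)).
  by apply: lin_contD; [exact: lin_cont_id|exact/lin_contN/lin_cont_comp].
have ex y : exists x, i x = y - q (r y).
  have : range i (y - q (r y)) by rewrite imi /= (lcD hr) (lcN hr) rq subrr.
  by case=> x _ <-; exists x.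
pose j y := xget 0 [set x | i x = y - q (r y)].
have ij y : i (j y) = y - q (r y) by exact: (xgetPex 0 (ex y)).
exists j; split=> //.
- split; first by move=> a x y; apply: inji; rewrite ij hi.1 !ij hP.1.
  apply/continuousP => A /oi[B oB ->].
  have -> : j @^-1` (i @^-1` B) = (fun y => y - q (r y)) @^-1` B.
    by apply/seteqP; split=> y /=; rewrite ij.
  by move/continuousP : hP.2; exact.
- move=> x; apply: inji; rewrite ij.
  have : [set y | r y = 0] (i x) by rewrite -imi; exists x.
  by move=> /= ->; rewrite (lc0 hq) subr0.
Qed.

End Calculus.

(** * Lie algebras and their low-degree forms *)

Section LieAlgebra.
Context {R : realType} (g : lieTvsType R).
Implicit Types x y z : g.

Lemma lieNl x y : [Lie - x, y] = - [Lie x, y].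
Proof. exact: (bcNl (@lie_bilin_cont R g)). Qed.

Lemma lieNr x y : [Lie x, - y] = - [Lie x, y].
Proof. exact: (bcNr (@lie_bilin_cont R g)). Qed.

Lemma lie0l x : [Lie 0, x] = 0.
Proof. exact: (bc0l (@lie_bilin_cont R g)). Qed.

Lemma lie_leibniz x y z :
  [Lie [Lie x, y], z] + [Lie y, [Lie x, z]] = [Lie x, [Lie y, z]].
Proof.
apply: (eq_from_sub (esym (lie_jacobi x y z))).
by rewrite (lieC z x) lieNr (lieC z); zmod.
Qed.

Lemma lie_jacobi_left x y z :
  [Lie [Lie x, y], z] - [Lie [Lie x, z], y] + [Lie [Lie y, z], x] = 0.
Proof.
apply: (eq_from_sub (lie_leibniz x y z)).
by rewrite (lieC [Lie x, z]) (lieC [Lie y, z]); zmod.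
Qed.

End LieAlgebra.

Section Forms.
Context {R : realType} {g : lieTvsType R} {W : tvsType R}.
Implicit Types b w : g -> g -> W.

Lemma alternating_skew b : bilin_cont b -> (forall X, b X X = 0) ->
  forall X Y, b X Y = - b Y X.
Proof.
move=> hb alt X Y; apply: (eq_from_sub (alt (X + Y))).
by rewrite (bcDl hb) !(bcDr hb) !alt; zmod.
Qed.

Lemma delta2D b w : delta2 (b + w) = delta2 b + delta2 w.
Proof.
apply/funext => X; apply/funext => Y; apply/funext => Z.
by rewrite /delta2 !fctE; zmod.
Qed.

Lemma delta2_trilin b : bilin_cont b -> trilin_cont (delta2 b).
Proof.
move=> hb; have tb := trilin_cont_comp2 hb (@lie_bilin_cont R g).
apply: trilin_contD; last exact/trilin_contN/(trilin_cont_rot tb).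
by apply: trilin_contD; [exact: trilin_contN|exact: (trilin_cont_swap tb)].
Qed.

Section Differential.
Context (b : g -> g -> W) (hb : bilin_cont b).

Lemma delta2_alternating X Y :
  [/\ delta2 b X X Y = 0, delta2 b X Y X = 0 & delta2 b Y X X = 0].
Proof.
rewrite /delta2 lie_alternating (bc0l hb) (lieC Y X) (bcNl hb).
by split; zmod.
Qed.

Lemma delta2_swap X Y Z : delta2 b X Y Z = - delta2 b Y X Z.
Proof. by rewrite /delta2 (lieC Y X) (bcNl hb); zmod. Qed.

Lemma delta2_rot X Y Z : delta2 b X Y Z = delta2 b Y Z X.
Proof.
by rewrite /delta2 (lieC Z X) (lieC Y X) !(bcNl hb); zmod.
Qed.

Lemma delta3_delta2 : (forall X, b X X = 0) -> delta3 (delta2 b) = 0.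
Proof.
move=> alt.
have J X Y Z W' : b [Lie [Lie X, Y], Z] W' - b [Lie [Lie X, Z], Y] W'
    + b [Lie [Lie Y, Z], X] W' = 0.
  by rewrite -(bcNl hb) -!(bcDl hb) lie_jacobi_left (bc0l hb).
have S := alternating_skew hb alt.
apply/funext => X1; apply/funext => X2; apply/funext => X3; apply/funext => X4.
(* The twelve terms with a double bracket form four Jacobi sums, one for each
   argument left outside; the remaining terms cancel by skew-symmetry. *)
have E : (b [Lie [Lie X1, X2], X3] X4 - b [Lie [Lie X1, X3], X2] X4
    + b [Lie [Lie X2, X3], X1] X4) -
  (b [Lie [Lie X1, X2], X4] X3 - b [Lie [Lie X1, X4], X2] X3
    + b [Lie [Lie X2, X4], X1] X3) +
  (b [Lie [Lie X1, X3], X4] X2 - b [Lie [Lie X1, X4], X3] X2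
    + b [Lie [Lie X3, X4], X1] X2) -
  (b [Lie [Lie X2, X3], X4] X1 - b [Lie [Lie X2, X4], X3] X1
    + b [Lie [Lie X3, X4], X2] X1) = 0 by rewrite !J; zmod.
transitivity (0 : W); last by [].
apply: (eq_from_sub E); rewrite /delta3 /delta2.
rewrite (S [Lie X3, X4] [Lie X1, X2]) (S [Lie X2, X4] [Lie X1, X3]).
by rewrite (S [Lie X2, X3] [Lie X1, X4]); zmod.
Qed.

End Differential.

End Forms.

Section Alt2Space.
Context {R : realType} (f : lieTvsType R) (W : tvsType R) (V : set W).
Context (V0 : V 0).
Context (VD : forall (a : R) x y, V x -> V y -> V (a *: x + y)).

Lemma Alt2_linear (a : R) w w' :
  Alt2 f V w -> Alt2 f V w' -> Alt2 f V (a *: w + w').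
Proof.
move=> [hw Vw alt] [hw' Vw' alt']; split.
- exact: (bilin_contD (bilin_contZ a hw) hw').
- by move=> X Y; exact: VD.
- by move=> X; rewrite !fctE alt alt' scaler0 addr0.
Qed.

Lemma delta2_linear (a : R) (w w' : f -> f -> W) :
  delta2 (a *: w + w') = a *: delta2 w + delta2 w'.
Proof.
apply/funext => X; apply/funext => Y; apply/funext => Z.
by rewrite /delta2 !fctE !scalerDr !scalerN; zmod.
Qed.

Lemma Alt2_cl_linear (a : R) w w' :
  Alt2_cl f V w -> Alt2_cl f V w' -> Alt2_cl f V (a *: w + w').
Proof.
move=> [hw dw] [hw' dw']; split; first exact: Alt2_linear.
by rewrite delta2_linear dw dw' scaler0 addr0.
Qed.

Lemma Alt2_0 : Alt2 f V 0.
Proof. by split=> // *; exact: bilin_cont0. Qed.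

Lemma Alt2_cl0 : Alt2_cl f V 0.
Proof.
split; first exact: Alt2_0.
apply/funext => X; apply/funext => Y; apply/funext => Z.
by change (- 0 + 0 - 0 = 0 :> W); zmod.
Qed.

Lemma Tspace_linear (a : R) b b' :
  Tspace f V b -> Tspace f V b' -> Tspace f V (a *: b + b').
Proof.
move=> [hb Vb Tb] [hb' Vb' Tb']; split.
- exact: (bilin_contD (bilin_contZ a hb) hb').
- by move=> X Y; exact: VD.
- by move=> X Y Z; rewrite !fctE -(Tb X) -(Tb' X) scalerDr; zmod.
Qed.

Lemma Tspace0 : Tspace f V 0.
Proof. by split=> // *; [exact: bilin_cont0|exact: addr0]. Qed.

(** On alternating forms the left Leibniz identity of [Tspace] is the
    vanishing of the differential. *)
Lemma Tspace_Alt2 w : Alt2 f V w -> Tspace f V w <-> delta2 w = 0.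
Proof.
move=> [hw Vw alt]; have S := alternating_skew hw alt; split=> [[_ _ Tw]|dw].
  apply/funext => X; apply/funext => Y; apply/funext => Z.
  transitivity (0 : W); last by [].
  apply: (eq_from_sub (esym (Tw X Y Z))); rewrite /delta2.
  by rewrite (S [Lie X, Z]) (S [Lie Y, Z]); zmod.
split=> // X Y Z.
have : delta2 w X Y Z = 0 by rewrite dw.
move=> /esym/eq_from_sub; apply; rewrite /delta2.
by rewrite (S [Lie X, Z]) (S [Lie Y, Z]); zmod.
Qed.

Lemma class3_eqP (c c' : f -> f -> f -> W) :
  class3 V c = class3 V c' <-> exists2 w, Alt2 f V w & c' = c + delta2 w.
Proof.
have opp w : Alt2 f V w -> Alt2 f V (- w).
  move=> Aw; have := Alt2_linear (-1) Aw Alt2_0.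
  by rewrite scaleN1r addr0.
have delta2N (w : f -> f -> W) : delta2 (- w) = - delta2 w.
  have := delta2_linear (-1) w 0; rewrite addr0 !scaleN1r.
  by have [_ ->] := Alt2_cl0; rewrite addr0.
split=> [e|[w Aw ->]].
  have : class3 V c c' by rewrite e; exists 0; [exact: Alt2_0|
    have [_ ->] := Alt2_cl0; rewrite addr0].
  by [].
apply/seteqP; split=> _ [w' Aw' ->].
- exists (w' - w); last by rewrite delta2D delta2N; zmod.
  by have := Alt2_linear 1 Aw' (opp _ Aw); rewrite scale1r; apply.
- exists (w + w'); last by rewrite delta2D; zmod.
  by have := Alt2_linear 1 Aw Aw'; rewrite scale1r; apply.
Qed.

End Alt2Space.

(** * Crossed modules and their quotient Lie algebra *)

Section CrossedModule.
Context {R : realType} (G : crossedModule R).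
Local Notation g := (cm_g G).
Local Notation h := (cm_h G).
Local Notation f := (cm_f G).
Local Notation t := (cm_t G).
Local Notation alpha := (cm_act G).
Local Notation p := (@cm_p R G).
Implicit Types (X Y Z : g) (x y : h) (u v : g -> h) (s : f -> g).

Let t_lin : lin_cont t := (cm_t_hom G).1.
Let act_bilin : bilin_cont alpha := @cm_act_bilin R G.

Lemma cm_p_lin_cont : lin_cont (p : g -> f).
Proof. by split; [exact: cm_p_linear|exact: cm_p_continuous]. Qed.

Lemma cm_p_lie X Y : p [Lie X, Y] = [Lie (p X : f), p Y].
Proof. exact/esym/cm_f_bracketE. Qed.

Lemma cm_p_t x : p (t x) = 0.
Proof. by rewrite -(cm_p0 G); apply/cm_p_eq; exists x; rewrite subr0. Qed.

Lemma cm_p_ker X : p X = 0 -> exists x, t x = X.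
Proof. by rewrite -(cm_p0 G) => /cm_p_eq[x e]; exists x; rewrite e subr0. Qed.

Lemma cm_pB X Y : p (X - Y) = p X - p Y :> f.
Proof. by rewrite (lcD cm_p_lin_cont) (lcN cm_p_lin_cont). Qed.

Lemma cm_p_range : range (p : g -> f) = setT.
Proof.
by apply/seteqP; split=> // z _; exists (repr z) => //; exact: cm_p_surj.
Qed.

Lemma lie_t x Y : [Lie t x, Y] = t (- alpha Y x).
Proof. by rewrite lieC (lcN t_lin) cm_t_act. Qed.

Lemma cm_a0 : cm_a G 0. Proof. exact: cm_t0. Qed.

Lemma cm_a_linear (a : R) x y : cm_a G x -> cm_a G y -> cm_a G (a *: x + y).
Proof.
move=> tx ty; have := cm_tD (G := G) a x y.
by rewrite [t x]tx [t y]ty scaler0 addr0.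
Qed.

Section FixedSection.
Context (s : f -> g) (hs : cm_section s).

Lemma rho_lin_cont : lin_cont (rho s).
Proof.
apply: lin_contD; first exact: lin_cont_id.
by apply/lin_contN/lin_cont_comp; [exact: hs.1|exact: cm_p_lin_cont].
Qed.

Lemma rho_t x : rho s (t x) = t x.
Proof. by rewrite /rho cm_p_t (lc0 hs.1) subr0. Qed.

Lemma cm_p_rho X : p (rho s X) = 0 :> f.
Proof. by rewrite /rho cm_pB hs.2 subrr. Qed.

Lemma rho_section X : X = rho s X + s (p X).
Proof. by rewrite /rho subrK. Qed.

(** A multilinear map on [g] killed by [t h] in each argument is pulled back
    from [f]; the section [s] provides the map on [f]. *)
Lemma basic2_section (W : tvsType R) (b : g -> g -> W) : bilin_cont b ->
  (forall x Y, b (t x) Y = 0) -> (forall X y, b X (t y) = 0) ->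
  forall X Y, b (s (p X)) (s (p Y)) = b X Y.
Proof.
move=> hb b1 b2 X Y; rewrite {2}(rho_section X) {2}(rho_section Y).
have [x <-] := cm_p_ker (cm_p_rho X); have [y <-] := cm_p_ker (cm_p_rho Y).
by rewrite (bcDl hb) b1 (bcDr hb) b2 !add0r.
Qed.

Lemma basic3_section (W : tvsType R) (c : g -> g -> g -> W) : trilin_cont c ->
  (forall x Y Z, c (t x) Y Z = 0) -> (forall x Y Z, c Y (t x) Z = 0) ->
  (forall x Y Z, c Y Z (t x) = 0) ->
  forall X Y Z, c (s (p X)) (s (p Y)) (s (p Z)) = c X Y Z.
Proof.
move=> [l1 l2 l3 _] c1 c2 c3 X Y Z.
rewrite {2}(rho_section X) {2}(rho_section Y) {2}(rho_section Z).
have [x <-] := cm_p_ker (cm_p_rho X); have [y <-] := cm_p_ker (cm_p_rho Y).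
have [z <-] := cm_p_ker (cm_p_rho Z).
rewrite (linearMD (l1 _ _)) c1 (linearMD (l2 _ _)) c2 (linearMD (l3 _ _)) c3.
by rewrite !add0r.
Qed.

End FixedSection.

Lemma half_splitting_ker u X : half_splitting u -> p X = 0 -> t (u X) = X.
Proof. by move=> hu /cm_p_ker[x <-]; exact: hu.2. Qed.

(** A half splitting can be corrected to project along any given section. *)
Lemma half_splitting_rho u s : half_splitting u -> cm_section s ->
  exists2 v : g -> h, half_splitting v & forall X, t (v X) = rho s X.
Proof.
move=> hu hs; exists (fun X => u (rho s X)).
- split; first by apply: lin_cont_comp; [exact: hu.1|exact: rho_lin_cont].
  by move=> x; rewrite (rho_t hs) hu.2.
- by move=> X; rewrite (half_splitting_ker hu (cm_p_rho hs X)).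
Qed.

(** The complementary projection [1 - t u] kills [t h], so it factors through [p];
    the factor is a section. *)
Lemma half_splitting_section u : half_splitting u ->
  exists2 s, cm_section s & forall X, t (u X) = rho s X.
Proof.
move=> hu; have hq : lin_cont (fun X => X - t (u X)).
  apply: lin_contD; first exact: lin_cont_id.
  by apply/lin_contN/lin_cont_comp; [exact: t_lin|exact: hu.1].
have [s hs sp] := open_descent cm_p_lin_cont hq cm_p_range (@cm_p_open R G)
  (fun X pX => etrans (congr1 (fun Y => X - Y) (half_splitting_ker hu pX))
    (subrr X)).
exists s; last by move=> X; rewrite /rho sp subKr.
split=> // z; rewrite -(cm_p_surj z) sp cm_pB cm_p_t subr0.
by rewrite cm_p_surj.
Qed.

(** Centrality: the action sees elements of [h] only through [t]. *)
Lemma central_act (cent : central G) X x y : t x = t y -> alpha X x = alpha X y.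
Proof.
move=> xy; apply/eqP; rewrite -subr_eq0 -(bcNr act_bilin) -(bcDr act_bilin).
by apply/eqP/cent; rewrite /cm_a /= (lcD t_lin) (lcN t_lin) xy subrr.
Qed.

(** * Skew lifts of the bracket and the Kassel-Loday class *)

(** The form [KL_omega u] of a half splitting and the skew part of an
    adjustment are both of this kind, and these properties are all that
    matters for the class of their differential. *)
Definition skew_lift (s : f -> g) (b : g -> g -> h) : Prop :=
  [/\ bilin_cont b, forall X, b X X = 0, forall x Y, b (t x) Y = - alpha Y x &
      forall X Y, t (b X Y) = rho s [Lie X, Y]].

Lemma skew_lift_omega (cent : central G) s u :
  half_splitting u -> (forall X, t (u X) = rho s X) ->
  skew_lift s (KL_omega u).
Proof.
move=> hu tu; have hperp : lin_cont (fun X => X - t (u X)).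
  apply: lin_contD; first exact: lin_cont_id.
  by apply/lin_contN/lin_cont_comp; [exact: t_lin|exact: hu.1].
split.
- have hau := bilin_cont_pre (@lin_cont_id R g) hu.1 act_bilin.
  apply: bilin_contD; first apply: bilin_contD; first apply: bilin_contD => //.
  + exact/bilin_contN/(bilin_cont_flip hau).
  + exact/bilin_contN/(bilin_cont_pre hu.1 hu.1 (@lie_bilin_cont R h)).
  + apply: (bilin_cont_post hu.1).
    exact: (bilin_cont_pre hperp hperp (@lie_bilin_cont R g)).
- by move=> X; rewrite /KL_omega !lie_alternating (lc0 hu.1); zmod.
- move=> x Y; rewrite /KL_omega hu.2 subrr lie0l (lc0 hu.1).
  rewrite -[[Lie u (t x), _]]cm_act_t hu.2 cm_act_t.
  by rewrite (central_act cent Y (hu.2 x)); zmod.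
- move=> X Y; rewrite /KL_omega !(lcD t_lin) !(lcN t_lin) !cm_t_act.
  rewrite (cm_t_hom G).2 (tu [Lie _, _]) /rho cm_p_lie !cm_pB !cm_p_t !subr0.
  rewrite -cm_p_lie !lieDl !lieDr !lieNl !lieNr (lieC Y (t (u X))); zmod.
Qed.

Section SkewLift.
Context (s : f -> g) (b : g -> g -> h).
Context (hs : cm_section s) (hb : skew_lift s b).

Let b_bilin : bilin_cont b. Proof. by case: hb. Qed.
Let b_alt X : b X X = 0. Proof. by case: hb. Qed.
Let b_t x Y : b (t x) Y = - alpha Y x. Proof. by case: hb. Qed.
Let t_b X Y : t (b X Y) = rho s [Lie X, Y]. Proof. by case: hb. Qed.

Lemma skew_lift_tr X y : b X (t y) = alpha X y.
Proof. by rewrite (alternating_skew b_bilin b_alt) b_t opprK. Qed.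

Lemma skew_lift_delta_t x Y Z : delta2 b (t x) Y Z = 0.
Proof.
rewrite /delta2 !lie_t !b_t skew_lift_tr cm_act_lie !(bcNr act_bilin).
zmod.
Qed.

Lemma skew_lift_t_delta X Y Z : t (delta2 b X Y Z) = 0.
Proof.
rewrite /delta2 !(lcD t_lin) !(lcN t_lin) !t_b.
have hr := rho_lin_cont hs.
rewrite -(lcN hr) -!(lcD hr) -(lcN hr) -(lcD hr).
rewrite -[RHS](lc0 hr); congr (rho s _).
by apply: (eq_from_sub (esym (lie_jacobi_left X Y Z))); zmod.
Qed.

(** The differential of a skew lift vanishes on [t h], because [alpha] is an action,
    and is killed by [t], because of the Jacobi identity; so it comes from a form
    on [f] with values in [a]. *)
Lemma skew_lift_curvature :
  exists2 C, Alt3_cl f (cm_a G) C & delta2 b = pull3 C.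
Proof.
have dt := delta2_trilin b_bilin.
pose C (x y z : f) := delta2 b (s x) (s y) (s z).
have CE X Y Z : C (p X) (p Y) (p Z) = delta2 b X Y Z.
  apply: (basic3_section hs dt).
  - exact: skew_lift_delta_t.
  - by move=> x Y' Z'; rewrite delta2_swap// skew_lift_delta_t oppr0.
  - by move=> x Y' Z'; rewrite -delta2_rot// skew_lift_delta_t.
exists C; last first.
  by apply/funext => X; apply/funext => Y; apply/funext => Z; rewrite /pull3 CE.
split; first split.
- exact: (trilin_cont_pre hs.1 dt).
- by move=> x y z; exact: skew_lift_t_delta.
- by move=> x y; exact: delta2_alternating.
apply/funext => x1; apply/funext => x2; apply/funext => x3; apply/funext => x4.
rewrite /delta3 -(cm_p_surj x1) -(cm_p_surj x2) -(cm_p_surj x3).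
rewrite -(cm_p_surj x4) -!cm_p_lie !CE.
have := delta3_delta2 b_bilin b_alt.
by move=> /(congr1 (fun c => c (repr x1) (repr x2) (repr x3) (repr x4))).
Qed.

Lemma skew_lift_shift w : Alt2 f (cm_a G) w -> skew_lift s (b + pull2 w).
Proof.
move=> [hw aw alt]; split.
- exact: (bilin_contD b_bilin (bilin_cont_pre cm_p_lin_cont cm_p_lin_cont hw)).
- by move=> X; rewrite /pull2 !fctE b_alt alt addr0.
- by move=> x Y; rewrite /pull2 !fctE b_t cm_p_t (bc0l hw) addr0.
- by move=> X Y; rewrite /pull2 !fctE (lcD t_lin) t_b [t (w _ _)]aw addr0.
Qed.

End SkewLift.

Lemma delta2_pull2 (w : f -> f -> h) : delta2 (pull2 w) = pull3 (delta2 w).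
Proof.
apply/funext => X; apply/funext => Y; apply/funext => Z.
by rewrite /pull3 /delta2 -!cm_p_lie.
Qed.

Lemma pull2_inj : injective (@pull2 R G).
Proof.
move=> w w' e; apply/funext => x; apply/funext => y.
have := congr1 (fun b => b (repr x) (repr y)) e.
by rewrite /pull2 !cm_p_surj.
Qed.

Lemma pull3_inj : injective (@pull3 R G).
Proof.
move=> w w' e; apply/funext => x; apply/funext => y; apply/funext => z.
have := congr1 (fun b => b (repr x) (repr y) (repr z)) e.
by rewrite /pull3 !cm_p_surj.
Qed.

(** Two skew lifts agree on [t h] and have the same image under [t]. *)
Lemma skew_lift_diff s b b' : cm_section s -> skew_lift s b ->
  skew_lift s b' -> exists2 w, Alt2 f (cm_a G) w & b' = b + pull2 w.
Proof.
move=> hs hb hb'; have [b1 b2 b3 b4] := hb; have [b1' b2' b3' b4'] := hb'.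
have hd : bilin_cont (b' - b) := bilin_contD b1' (bilin_contN b1).
pose w (x y : f) := (b' - b) (s x) (s y).
have wE X Y : w (p X) (p Y) = b' X Y - b X Y.
  apply: (basic2_section hs hd) => [x Y'|X' y].
  - by rewrite !fctE b3 b3' subrr.
  - by rewrite !fctE (skew_lift_tr hb) (skew_lift_tr hb') subrr.
exists w.
- split; first exact: (bilin_cont_pre hs.1 hs.1 hd).
  + move=> x y; rewrite /w !fctE /cm_a /= (lcD t_lin) (lcN t_lin) b4 b4'.
    exact: subrr.
  + by move=> x; rewrite /w !fctE b2 b2' subrr.
- by apply/funext => X; apply/funext => Y; rewrite /pull2 !fctE wE; zmod.
Qed.

(** Passing to another section adds to the lift a linear function of the
    bracket, whose differential vanishes by the Jacobi identity. *)
Lemma skew_lift_section u s s' b : half_splitting u ->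
  cm_section s -> cm_section s' -> skew_lift s b ->
  exists2 b', skew_lift s' b' & delta2 b' = delta2 b.
Proof.
move=> hu hs hs' [b1 b2 b3 b4].
have hl : lin_cont (fun X => u (s (p X) - s' (p X))).
  apply: (lin_cont_comp hu.1); apply: lin_contD; last apply: lin_contN.
  - exact: (lin_cont_comp hs.1 cm_p_lin_cont).
  - exact: (lin_cont_comp hs'.1 cm_p_lin_cont).
set l := fun X => _ in hl.
have lt x : l (t x) = 0.
  by rewrite /l cm_p_t (lc0 hs.1) (lc0 hs'.1) subrr (lc0 hu.1).
have tl X : t (l X) = s (p X) - s' (p X).
  by rewrite /l (half_splitting_ker hu)// cm_pB hs.2 hs'.2 subrr.
exists (fun X Y => b X Y + l [Lie X, Y]); first split.
- exact/bilin_contD/(bilin_cont_post hl (@lie_bilin_cont R g)).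
- by move=> X; rewrite b2 lie_alternating (lc0 hl) addr0.
- by move=> x Y; rewrite b3 lie_t lt addr0.
- by move=> X Y; rewrite (lcD t_lin) b4 tl /rho; zmod.
apply/funext => X; apply/funext => Y; apply/funext => Z.
have := congr1 l (lie_jacobi_left X Y Z).
rewrite !(lcD hl) (lcN hl) (lc0 hl) => /esym/eq_from_sub; apply.
by rewrite /delta2; zmod.
Qed.

Lemma skew_lift_class u s s' b b' C C' : half_splitting u ->
  cm_section s -> cm_section s' -> skew_lift s b -> skew_lift s' b' ->
  delta2 b = pull3 C -> delta2 b' = pull3 C' ->
  class3 (cm_a G) C = class3 (cm_a G) C'.
Proof.
move=> hu hs hs' hb hb' dC dC'.
have [b0 hb0 db0] := skew_lift_section hu hs hs' hb.
have [w Aw b'E] := skew_lift_diff hs' hb0 hb'.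
apply/(class3_eqP cm_a0 cm_a_linear); exists w => //; apply: pull3_inj.
by rewrite -dC' b'E delta2D db0 dC delta2_pull2.
Qed.

Lemma KL_form_spec (cent : central G) u : half_splitting u ->
  Alt3_cl f (cm_a G) (KL_form u) /\ delta2 (KL_omega u) = pull3 (KL_form u).
Proof.
move=> hu; have [s hs tu] := half_splitting_section hu.
have [C hC dC] := skew_lift_curvature hs (skew_lift_omega cent hu tu).
suff : [set C' | Alt3_cl f (cm_a G) C' /\ delta2 (KL_omega u) = pull3 C']
  (KL_form u) by [].
by apply: xgetPex; exists C.
Qed.

Lemma KL_skew_lift (cent : central G) (u : g -> h) s b C : half_splitting u ->
  cm_section s -> skew_lift s b -> delta2 b = pull3 C ->
  KL G = class3 (cm_a G) C.
Proof.
move=> hu hs hb dC.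
have E v : half_splitting v -> class3 (cm_a G) C = class3 (cm_a G) (KL_form v).
  move=> hv; have [s' hs' tv] := half_splitting_section hv.
  have [_] := KL_form_spec cent hv; have hb' := skew_lift_omega cent hv tv.
  exact: (skew_lift_class hu hs hs' hb hb' dC).
have [_ /(_ u hu) ->] : [set c | H3 f (cm_a G) c /\
    forall v : g -> h, half_splitting v -> c = class3 (cm_a G) (KL_form v)]
    (KL G).
  apply: xgetPex; exists (class3 (cm_a G) C); split=> //.
  exists C => //; have [C' hC'] := skew_lift_curvature hs hb.
  by rewrite dC => /pull3_inj ->.
exact/esym/E.
Qed.

End CrossedModule.

(** * Infinitesimal adjustments *)

Section Adjustments.
Context {R : realType} (G : crossedModule R).
Local Notation g := (cm_g G).
Local Notation h := (cm_h G).
Local Notation f := (cm_f G).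
Local Notation t := (cm_t G).
Local Notation alpha := (cm_act G).
Local Notation p := (@cm_p R G).
Implicit Types (X Y Z : g) (x y : h) (u : g -> h) (s : f -> g)
  (eta : g -> g -> h) (B : f -> f -> h).

Let t_lin : lin_cont t := (cm_t_hom G).1.

Lemma halfK (V : lmodType R) (v : V) : 2^-1 *: (v + v) = v.
Proof.
by rewrite -mulr2n -(scaler_nat 2 v) scalerA mulVf ?scale1r// pnatr_eq0.
Qed.

Lemma adj_diff s eta eta' : cm_section s -> Adj G eta -> Adj G eta' ->
  exists2 b, Tspace f setT b & eta' = adj_shift eta b.
Proof.
move=> hs [e1 e2 e3 e4] [e1' e2' e3' e4'].
have hd : bilin_cont (eta' - eta) := bilin_contD e1' (bilin_contN e1).
pose b (x y : f) := (eta' - eta) (s x) (s y).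
have bE X Y : b (p X) (p Y) = eta' X Y - eta X Y.
  apply: (basic2_section hs hd) => [x Y'|X' y].
  - by rewrite !fctE e3 e3' subrr.
  - by rewrite !fctE e4 e4' subrr.
exists b; last first.
  apply/funext => X; apply/funext => Y.
  by rewrite /adj_shift /pull2 !fctE bE; zmod.
split=> // [|x y z]; first exact: (bilin_cont_pre hs.1 hs.1 hd).
rewrite -(cm_p_surj x) -(cm_p_surj y) -(cm_p_surj z) -!cm_p_lie !bE.
by rewrite -(e2 (repr x)) -(e2' (repr x)); zmod.
Qed.

Lemma adj_shiftP eta b :
  Adj G eta -> Tspace f setT b -> Adj G (adj_shift eta b).
Proof.
move=> [e1 e2 e3 e4] [hb _ Tb]; split.
- exact: (bilin_contD e1 (bilin_cont_pre (@cm_p_lin_cont R G)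
    (@cm_p_lin_cont R G) hb)).
- move=> X Y Z; rewrite /adj_shift /pull2 !fctE -(e2 X) !cm_p_lie -(Tb (p X)).
  by zmod.
- by move=> x Y; rewrite /adj_shift /pull2 !fctE e3 cm_p_t (bc0l hb) addr0.
- by move=> X y; rewrite /adj_shift /pull2 !fctE e4 cm_p_t (bc0r hb) addr0.
Qed.

Lemma Tspace_sub (V : set h) b : Tspace f V b -> Tspace f setT b.
Proof. by case. Qed.

(** The defect [rho s [X, Y] - t (eta X Y)] vanishes on [t h] and takes values in
    [t h], so it is the image under [t] of a bilinear map on [f]. That map
    satisfies the left Leibniz identity because the bracket, [t eta] and
    [s p] of the bracket all do. *)
Lemma adj_adapt u s eta : half_splitting u -> cm_section s -> Adj G eta ->
  exists eta', Adj_at G s eta'.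
Proof.
move=> hu hs he; have [e1 e2 e3 e4] := he.
have hc : bilin_cont (fun X Y => [Lie X, Y] - t (eta X Y)).
  apply: bilin_contD; first exact: (@lie_bilin_cont R g).
  exact/bilin_contN/(bilin_cont_post t_lin e1).
pose c (x y : f) := [Lie s x, s y] - t (eta (s x) (s y)).
have cE X Y : c (p X) (p Y) = [Lie X, Y] - t (eta X Y).
  apply: (basic2_section hs hc) => [x Y'|X' y].
  - by rewrite lie_t e3 subrr.
  - by rewrite e4 cm_t_act subrr.
have pc (x y : f) : p (c x y) = [Lie x, y].
  by rewrite /c cm_pB cm_p_t subr0 cm_p_lie !hs.2.
pose b (x y : f) := u (c x y - s [Lie x, y]).
have tb (x y : f) : t (b x y) = c x y - s [Lie x, y].
  by apply: half_splitting_ker => //; rewrite cm_pB pc hs.2 subrr.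
exists (adj_shift eta b); split.
  apply: adj_shiftP => //; split=> // [|x y z].
    apply: (bilin_cont_post hu.1); apply: bilin_contD.
      exact: (bilin_cont_pre hs.1 hs.1 hc).
    exact/bilin_contN/(bilin_cont_post hs.1 (@lie_bilin_cont R f)).
  rewrite -(cm_p_surj x) -(cm_p_surj y) -(cm_p_surj z) /b -!cm_p_lie !cE.
  rewrite -(lcD hu.1); congr (u _).
  rewrite -(lie_leibniz (repr x)) -(e2 (repr x)) cm_pD (lcD t_lin) (lcD hs.1).
  by zmod.
move=> X Y; rewrite /adj_shift /pull2 !fctE (lcD t_lin) tb cE /rho -cm_p_lie.
by zmod.
Qed.

Lemma adj_at_shift s eta b : Adj_at G s eta -> Tspace f (cm_a G) b ->
  Adj_at G s (adj_shift eta b).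
Proof.
move=> [he te] hb; split; first exact: (adj_shiftP he (Tspace_sub hb)).
have [_ ab _] := hb.
move=> X Y; rewrite /adj_shift /pull2 !fctE (lcD t_lin) te [t (b _ _)]ab.
exact: addr0.
Qed.

Lemma adj_at_diff s eta eta' : cm_section s -> Adj_at G s eta ->
  Adj_at G s eta' -> exists2 b, Tspace f (cm_a G) b & eta' = adj_shift eta b.
Proof.
move=> hs [he te] [he' te']; have [b hb e] := adj_diff hs he he'.
exists b => //; have [b1 _ b3] := hb; split=> // x y.
rewrite -(cm_p_surj x) -(cm_p_surj y).
have := te' (repr x) (repr y); rewrite e /adj_shift /pull2 !fctE (lcD t_lin) te.
by rewrite -[RHS]addr0 => /addrI.
Qed.

Lemma adj_shift0 eta : adj_shift eta 0 = eta.
Proof. by apply/funext => X; apply/funext => Y; exact: addr0. Qed.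

Lemma adj_shiftD eta b c :
  adj_shift eta (b + c) = adj_shift (adj_shift eta b) c.
Proof. by apply/funext => X; apply/funext => Y; exact: addrA. Qed.

Lemma adj_shift_inj eta : injective (adj_shift eta).
Proof. by move=> b c /addrI/pull2_inj. Qed.

Lemma affine_adj s : cm_section s ->
  affine_over (Tspace f setT) (Adj G) (@adj_shift R G).
Proof.
move=> hs; split.
- by split=> [|a b c]; [exact: Tspace0|exact: Tspace_linear].
- by move=> eta b; exact: adj_shiftP.
- by split=> *; [exact: adj_shift0|exact: adj_shiftD].
- by move=> eta b _ _ e; apply: (@adj_shift_inj eta); rewrite e adj_shift0.
- by move=> eta eta' he he'; have [b hb ->] := adj_diff hs he he'; exists b.
Qed.

Lemma affine_adj_at s : cm_section s ->
  affine_over (Tspace f (cm_a G)) (Adj_at G s) (@adj_shift R G).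
Proof.
move=> hs; split.
- split=> [|a b c]; first exact/Tspace0/cm_a0.
  by apply: Tspace_linear; exact: cm_a_linear.
- by move=> eta b; exact: adj_at_shift.
- by split=> *; [exact: adj_shift0|exact: adj_shiftD].
- by move=> eta b _ _ e; apply: (@adj_shift_inj eta); rewrite e adj_shift0.
- by move=> eta eta' he he'; have [b hb ->] := adj_at_diff hs he he'; exists b.
Qed.

(** * The adjusted Kassel-Loday class *)

(** Applying the Leibniz identity of [eta] to [eta Z [X, Y]] and to
    [eta [X, Y] Z] shows that the symmetrized form takes the same value on
    [([X, Y], Z)] and [([Z, X], Y)]; two such cyclic shifts and symmetry give
    ad-invariance. *)
Lemma adj_sym_invariant eta (S := fun X Y => eta X Y + eta Y X) : Adj G eta ->
  forall X Y Z, S [Lie X, Y] Z = S X [Lie Y, Z].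
Proof.
move=> [e1 e2 _ _]; have cyc X Y Z : S [Lie X, Y] Z = S [Lie Z, X] Y.
  rewrite /S -(e2 Z X Y); apply: (eq_from_sub (e2 X Y Z)).
  by rewrite (lieC Z Y) (lieC Z X) !(bcNr e1) !(bcNl e1); zmod.
by move=> X Y Z; rewrite -cyc -[LHS]cyc cyc /S addrC.
Qed.

(** The two boundary conditions on [eta] cancel in the symmetrization, and
    [t eta] is skew because the bracket is. *)
Lemma adj_sym_descends s eta : cm_section s -> Adj_at G s eta ->
  exists B, Sym2_ad f (cm_a G) B /\
    forall X Y, 2^-1 *: (eta X Y + eta Y X) = - B (p X) (p Y).
Proof.
move=> hs [he te]; have [e1 e2 e3 e4] := he.
pose S X Y := eta X Y + eta Y X.
have hS : bilin_cont S := bilin_contD e1 (bilin_cont_flip e1).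
have SE X Y : S (s (p X)) (s (p Y)) = S X Y.
  by apply: basic2_section => // [x Y'|X' y]; rewrite /S e3 e4; zmod.
exists (fun x y : f => - (2^-1 *: S (s x) (s y))); split; last first.
  by move=> X Y; rewrite opprK SE.
split.
- exact/bilin_contN/bilin_contZ/(bilin_cont_pre hs.1 hs.1 hS).
- move=> x y; rewrite /cm_a /= (lcN t_lin) (lcZ t_lin) (lcD t_lin) !te.
  have hr := rho_lin_cont hs.
  by rewrite -(lcD hr) (lieC (s x)) addNr (lc0 hr) scaler0 oppr0.
- by move=> x y; rewrite /S addrC.
- move=> x y z; rewrite -(cm_p_surj x) -(cm_p_surj y) -(cm_p_surj z).
  by rewrite -!cm_p_lie !SE [S _ _](adj_sym_invariant he).
Qed.

Lemma KL_adj_spec s eta : cm_section s -> Adj_at G s eta ->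
  Sym2_ad f (cm_a G) (KL_adj eta) /\
  forall X Y, 2^-1 *: (eta X Y + eta Y X) = - KL_adj eta (p X) (p Y).
Proof.
move=> hs he; suff : [set B | Sym2_ad f (cm_a G) B /\
    forall X Y, 2^-1 *: (eta X Y + eta Y X) = - B (p X) (p Y)]
    (KL_adj eta) by [].
by apply: xgetPex; exact: adj_sym_descends he.
Qed.

Lemma KL_adj_unique eta B B' :
  (forall X Y, 2^-1 *: (eta X Y + eta Y X) = - B (p X) (p Y)) ->
  (forall X Y, 2^-1 *: (eta X Y + eta Y X) = - B' (p X) (p Y)) -> B = B'.
Proof.
move=> e e'; apply: pull2_inj; apply/funext => X; apply/funext => Y.
by rewrite /pull2; apply: oppr_inj; rewrite -e -e'.
Qed.

(** Removing from an adapted adjustment its symmetric part [- B] leaves a skew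
    lift, and the Leibniz identity becomes the equation [delta b = cw B]. *)
Lemma adj_at_skew_lift s eta B : Adj_at G s eta -> Sym2_ad f (cm_a G) B ->
  (forall X Y, 2^-1 *: (eta X Y + eta Y X) = - B (p X) (p Y)) ->
  skew_lift s (eta + pull2 B) /\ delta2 (eta + pull2 B) = pull3 (cw B).
Proof.
move=> [[e1 e2 e3 e4] te] [B1 B2 B3 B4] eB.
have hA : bilin_cont (eta + pull2 B).
  exact: (bilin_contD e1 (bilin_cont_pre (@cm_p_lin_cont R G)
    (@cm_p_lin_cont R G) B1)).
have alt X : (eta + pull2 B) X X = 0.
  by rewrite /pull2 !fctE -[eta X X]halfK eB addNr.
split; first split=> //.
- by move=> x Y; rewrite /pull2 !fctE e3 cm_p_t (bc0l B1) addr0.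
- by move=> X Y; rewrite /pull2 !fctE (lcD t_lin) te [t (B _ _)]B2 addr0.
apply/funext => X; apply/funext => Y; apply/funext => Z.
have S := alternating_skew hA alt.
rewrite /delta2 (S [Lie X, Z]) (S [Lie Y, Z]) /pull3 /cw /pull2 !fctE.
rewrite !cm_p_lie -(e2 X) -[B (p X) [Lie p Y, p Z]]B4.
rewrite -[B (p Y) [Lie p X, p Z]]B4 (lieC (p Y)) (bcNl B1).
by zmod.
Qed.

Lemma skew_lift_adj_at s b B : cm_section s -> skew_lift s b ->
  Sym2_ad f (cm_a G) B -> delta2 b = pull3 (cw B) ->
  Adj_at G s (b - pull2 B) /\ KL_adj (b - pull2 B) = B.
Proof.
move=> hs hb hB db; have [b1 b2 b3 b4] := hb; have [B1 B2 B3 B4] := hB.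
have S := alternating_skew b1 b2.
have he : Adj_at G s (b - pull2 B).
  split; last first.
    move=> X Y; rewrite /pull2 !fctE (lcD t_lin) (lcN t_lin) b4.
    by rewrite [t (B _ _)]B2 subr0.
  split.
  - apply: (bilin_contD b1); apply: bilin_contN.
    exact: (bilin_cont_pre (@cm_p_lin_cont R G) (@cm_p_lin_cont R G) B1).
  - move=> X Y Z; have := congr1 (fun c => c X Y Z) db.
    rewrite /pull3 /delta2 /cw => E; apply: (eq_from_sub (esym E)).
    rewrite /pull2 !fctE (S [Lie X, Z]) (S [Lie Y, Z]) !cm_p_lie.
    rewrite -[B (p X) [Lie p Y, p Z]]B4 -[B (p Y) [Lie p X, p Z]]B4.
    by rewrite (lieC (p Y)) (bcNl B1); zmod.
  - by move=> x Y; rewrite /pull2 !fctE b3 cm_p_t (bc0l B1) subr0.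
  - move=> X y; rewrite /pull2 !fctE (skew_lift_tr hb) cm_p_t (bc0r B1).
    exact: subr0.
split=> //; have [_ e] := KL_adj_spec hs he; apply: (KL_adj_unique e) => X Y.
rewrite /pull2 !fctE (B3 (p Y)) (S Y X) -[RHS]halfK; congr (_ *: _); zmod.
Qed.

Lemma cw_KL_adj (cent : central G) u s eta : half_splitting u ->
  cm_section s -> Adj_at G s eta -> class3 (cm_a G) (cw (KL_adj eta)) = KL G.
Proof.
move=> hu hs he; have [hB eB] := KL_adj_spec hs he.
have [hb db] := adj_at_skew_lift he hB eB.
exact/esym/(KL_skew_lift cent hu hs hb db).
Qed.

Lemma KL_adj_surj (cent : central G) u s B : half_splitting u ->
  cm_section s -> Sym2_ad f (cm_a G) B -> class3 (cm_a G) (cw B) = KL G ->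
  exists eta, Adj_at G s eta /\ KL_adj eta = B.
Proof.
move=> hu hs hB; have [v hv tv] := half_splitting_rho hu hs.
have hb := skew_lift_omega cent hv tv.
have [C _ dC] := skew_lift_curvature hs hb.
rewrite (KL_skew_lift cent hu hs hb dC) => /esym.
move=> /(class3_eqP (@cm_a0 R G) (@cm_a_linear R G))[w Aw cwB].
exists (KL_omega v + pull2 w - pull2 B).
apply: (skew_lift_adj_at hs (skew_lift_shift hb Aw) hB).
by rewrite delta2D delta2_pull2 dC cwB.
Qed.

(** The symmetric part is unchanged exactly when [b] is alternating. *)
Lemma KL_adj_shift_eq s eta b : cm_section s -> Adj_at G s eta ->
  Tspace f (cm_a G) b ->
  KL_adj (adj_shift eta b) = KL_adj eta <-> Alt2_cl f (cm_a G) b.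
Proof.
move=> hs he hb; have [b1 b2 b3] := hb.
have [_ e] := KL_adj_spec hs he; have he' := adj_at_shift he hb.
have [_ e'] := KL_adj_spec hs he'; split=> [E|[[_ _ alt] _]].
- have alt (x : f) : b x x = 0.
    rewrite -(cm_p_surj x); have := e' (repr x) (repr x).
    by rewrite E -e !halfK /adj_shift /pull2 !fctE -[RHS]addr0 => /addrI.
  have Ab : Alt2 f (cm_a G) b by [].
  by split=> //; exact/(Tspace_Alt2 Ab).
- apply: (KL_adj_unique e') => X Y; rewrite -e /adj_shift /pull2 !fctE.
  by rewrite (alternating_skew b1 alt (p Y)); congr (_ *: _); zmod.
Qed.

End Adjustments.

(** * Butterflies and weak equivalence *)

Section Butterfly.
Context {R : realType} {G1 G2 : crossedModule R}.
Context (k : butterfly G1 G2).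
Local Notation i1 := (bf_i1 k).
Local Notation i2 := (bf_i2 k).
Local Notation r1 := (@bf_r1 _ _ _ k).
Local Notation r2 := (bf_r2 k).
Implicit Types X Y : bf_k k.

Let i1_lin : lin_cont i1 := (bf_i1_hom k).1.
Let i2_lin : lin_cont i2 := (bf_i2_hom k).1.
Let r1_lin : lin_cont r1 := (bf_r1_hom k).1.
Let r2_lin : lin_cont r2 := (bf_r2_hom k).1.

Lemma bf_i2_inj : injective i2. Proof. by case: (bf_exact k). Qed.

Lemma bf_r1i2 y : r1 (i2 y) = 0.
Proof.
have [_ e _ _ _] := bf_exact k.
suff : [set X | r1 X = 0] (i2 y) by [].
by rewrite -e; exists y.
Qed.

Lemma bf_r1_ker X : r1 X = 0 -> exists y, i2 y = X.
Proof.
have [_ e _ _ _] := bf_exact k; move=> r1X.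
have : [set X | r1 X = 0] X by [].
by rewrite -e => -[y _ <-]; exists y.
Qed.

(** Elements of [ker t1] have their image under [i1] in the kernel of [r1],
    hence in the range of [i2]. *)
Lemma bf_kernel_map : exists psi : cm_h G1 -> cm_h G2,
  [/\ lin_cont psi, forall y, cm_a G1 y -> cm_a G2 (psi y) &
      forall y, cm_a G1 y -> i2 (psi y) = i1 y].
Proof.
have [q [hq rq]] := bf_split k.
have [j [hj _ ij]] := split_exact_retraction i2_lin r1_lin (bf_exact k) hq rq.
have e y : cm_a G1 y -> i2 (j (i1 y)) = i1 y.
  by move=> ay; rewrite ij bf_r1i1 ay (lc0 hq) subr0.
exists (fun y => j (i1 y)); split=> //; first exact: lin_cont_comp.
by move=> y ay; rewrite /cm_a /= -(bf_r2i2 k) e// bf_r2i1.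
Qed.

Section Invertible.
Context (inv : bf_invertible k).

Lemma bf_i1_inj : injective i1. Proof. by case: inv. Qed.

Lemma bf_r2_ker X : r2 X = 0 -> exists y, i1 y = X.
Proof.
have [_ e _ _ _] := inv; move=> r2X.
have : [set X | r2 X = 0] X by [].
by rewrite -e => -[y _ <-]; exists y.
Qed.

(** Both quotients are the quotient of [bf_k k] by [i1 h1 + i2 h2]. *)
Lemma bf_quotient_map : exists phi : cm_f G2 -> cm_f G1,
  lie_hom phi /\ forall X, phi (cm_p (r2 X)) = cm_p (r1 X).
Proof.
have hp2 := lin_cont_comp (@cm_p_lin_cont R G2) r2_lin.
have hp1 := lin_cont_comp (@cm_p_lin_cont R G1) r1_lin.
have [_ _ r2T _ r2o] := inv.
have surj z : exists X, cm_p (r2 X) = z.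
  have : range r2 (repr z) by rewrite r2T.
  by case=> X _ e; exists X; rewrite e cm_p_surj.
have [] := open_descent hp2 hp1.
- by apply/seteqP; split=> // z _; have [X <-] := surj z; exists X.
- move=> A oA; have := cm_p_open (r2o _ oA); congr open.
  by rewrite image_comp.
- move=> X /cm_p_ker[y]; rewrite -(bf_r2i2 k) => e.
  have [|x xE] := @bf_r2_ker (X - i2 y).
    by rewrite (lcD r2_lin) (lcN r2_lin) e subrr.
  rewrite -[X](subrK (i2 y)) -xE (lcD r1_lin) bf_r1i2 bf_r1i1 addr0.
  exact: cm_p_t.
move=> phi hphi phiE; exists phi; split=> //; split=> // z w.
have [X <-] := surj z; have [Y <-] := surj w.
by rewrite -cm_p_lie -(bf_r2_hom k).2 !phiE (bf_r1_hom k).2 cm_p_lie.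
Qed.

(** A preimage of [X] under [r2] is first chosen up to the image of [t2] using
    the splitting of [r1], then corrected by [i2]. *)
Lemma bf_split_inv u2 s1 : half_splitting (G := G2) u2 ->
  cm_section (G := G1) s1 ->
  exists q, lin_cont q /\ forall z, r2 (q z) = z.
Proof.
move=> hu hs; have [phi [[hphi _] phiE]] := bf_quotient_map.
have [q [hq rq]] := bf_split k.
have hm : lin_cont (fun z => q (s1 (phi (cm_p z)))).
  apply: (lin_cont_comp hq); apply: (lin_cont_comp hs.1).
  exact: (lin_cont_comp hphi (@cm_p_lin_cont R G2)).
set m := fun z => _ in hm.
have pm z : cm_p (r2 (m z)) = cm_p z.
  have [_ _ r2T _ _] := inv.
  have : range r2 z by rewrite r2T.
  case=> Y _ <-; rewrite /m phiE; set Z := q _.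
  have : cm_p (r1 (Z - Y)) = 0.
    by rewrite (lcD r1_lin) (lcN r1_lin) rq cm_pB hs.2 subrr.
  move=> /cm_p_ker[x]; rewrite -(bf_r1i1 k) => e.
  have [|y yE] := @bf_r1_ker (Z - Y - i1 x).
    by rewrite (lcD r1_lin) (lcN r1_lin) -e subrr.
  rewrite -[Z](subrK Y) -[Z - Y](subrK (i1 x)) -yE !(lcD r2_lin).
  by rewrite bf_r2i1 bf_r2i2 addr0 (lcD (@cm_p_lin_cont R G2)) cm_p_t add0r.
exists (fun z => i2 (u2 (z - r2 (m z))) + m z); split.
  apply: lin_contD => //; apply: (lin_cont_comp i2_lin).
  apply: (lin_cont_comp hu.1); apply: lin_contD; first exact: lin_cont_id.
  exact/lin_contN/(lin_cont_comp r2_lin).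
move=> z; rewrite (lcD r2_lin) bf_r2i2 (half_splitting_ker hu) ?subrK//.
by rewrite cm_pB pm subrr.
Qed.

(** On the butterfly, the bilinear map sending [X] and [Y] to
    [[X, Y] - i1 (eta (r1 X) (r1 Y)) - q (s (p (r1 [X, Y])))] takes values in
    [ker r1 = i2 h2] because [eta] is adapted, and it vanishes when either
    argument lies in [ker r2 = i1 h1]; so it gives a map from [g2 x g2] to [h2].
    Each of its three terms satisfies the left Leibniz identity, and on [i2 h2]
    only the bracket survives, which yields the boundary conditions. *)
Lemma bf_adj (q2 : cm_g G2 -> bf_k k) s1 eta : lin_cont q2 ->
  (forall z, r2 (q2 z) = z) -> cm_section (G := G1) s1 ->
  Adj_at G1 s1 eta -> Adj G2 !=set0.
Proof.
move=> hq2 rq2 hs [[e1 e2 e3 e4] te].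
have [q [hq rq]] := bf_split k.
have [j [hj ji ij]] := split_exact_retraction i2_lin r1_lin (bf_exact k) hq rq.
have hm : lin_cont (fun X => q (s1 (cm_p (r1 X)))).
  apply: (lin_cont_comp hq); apply: (lin_cont_comp hs.1).
  exact: (lin_cont_comp (@cm_p_lin_cont R G1) r1_lin).
set m := fun X => _ in hm.
pose th X Y := [Lie X, Y] - i1 (eta (r1 X) (r1 Y)) - m [Lie X, Y].
have hth : bilin_cont th.
  apply: bilin_contD; first apply: bilin_contD.
  - exact: lie_bilin_cont.
  - exact/bilin_contN/(bilin_cont_post i1_lin)/bilin_cont_pre.
  - exact/bilin_contN/(bilin_cont_post hm (@lie_bilin_cont R _)).
have r1th X Y : r1 (th X Y) = 0.
  rewrite /th !(lcD r1_lin) !(lcN r1_lin) bf_r1i1 te (bf_r1_hom k).2 rq.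
  by rewrite (bf_r1_hom k).2 /rho; zmod.
have ijth X Y : i2 (j (th X Y)) = th X Y by rewrite ij r1th (lc0 hq) subr0.
have mi1 x : m (i1 x) = 0.
  by rewrite /m bf_r1i1 cm_p_t (lc0 hs.1) (lc0 hq).
have mi2 y : m (i2 y) = 0.
  by rewrite /m bf_r1i2 (lc0 (@cm_p_lin_cont R G1)) (lc0 hs.1) (lc0 hq).
have i1i2 x Y : [Lie i1 x, Y] = - i1 (cm_act G1 (r1 Y) x).
  by rewrite lieC bf_act1.
have i2_lie y Y : [Lie i2 y, Y] = - i2 (cm_act G2 (r2 Y) y).
  by rewrite lieC bf_act2.
have th1 x Y : th (i1 x) Y = 0.
  by rewrite /th i1i2 bf_r1i1 e3 !(lcN i1_lin) (lcN hm) mi1; zmod.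
have th2 X y : th X (i1 y) = 0.
  by rewrite /th -bf_act1 bf_r1i1 e4 mi1; zmod.
have thq X Y : th (q2 (r2 X)) (q2 (r2 Y)) = th X Y.
  have [|x xE] := @bf_r2_ker (X - q2 (r2 X)).
    by rewrite (lcD r2_lin) (lcN r2_lin) rq2 subrr.
  have [|y yE] := @bf_r2_ker (Y - q2 (r2 Y)).
    by rewrite (lcD r2_lin) (lcN r2_lin) rq2 subrr.
  rewrite -{2}[X](subrK (q2 (r2 X))) -{2}[Y](subrK (q2 (r2 Y))) -xE -yE.
  by rewrite (bcDl hth) th1 (bcDr hth) th2 !add0r.
have rT z : exists X, r2 X = z by exists (q2 z).
exists (fun z w => j (th (q2 z) (q2 w))); split.
- exact/(bilin_cont_post hj)/bilin_cont_pre.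
- move=> X Y Z; have [X' <-] := rT X; have [Y' <-] := rT Y; have [Z' <-] := rT Z.
  rewrite -!(bf_r2_hom k).2 !thq -(lcD hj); congr (j _).
  rewrite /th !(bf_r1_hom k).2 -(e2 (r1 X')) -(lie_leibniz X' Y').
  by rewrite (lcD i1_lin) (lcD hm); zmod.
- move=> y Y; have [Y' <-] := rT Y; rewrite -(bf_r2i2 k) thq.
  apply: bf_i2_inj; rewrite ijth /th i2_lie bf_r1i2 (bc0l e1) (lc0 i1_lin).
  by rewrite !(lcN hm) mi2 !(lcN i2_lin); zmod.
- move=> X y; have [X' <-] := rT X; rewrite -(bf_r2i2 k) thq.
  apply: bf_i2_inj; rewrite ijth /th -bf_act2 bf_r1i2 (bc0r e1) (lc0 i1_lin).
  by rewrite mi2; zmod.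
Qed.

Context (split2 : exists q, lin_cont q /\ forall z, r2 (q z) = z).

(** Exactness of the second sequence takes the place of the first; only the
    splitting of [r2] has to be supplied. *)
Definition butterfly_flip : butterfly G2 G1 :=
  @Butterfly R G2 G1 (bf_k k) i2 i1 r2 r1 (bf_i2_hom k) (bf_i1_hom k)
    (bf_r2_hom k) (bf_r1_hom k) (bf_r2i2 k) (bf_r1i1 k) bf_r1i2
    inv split2 (@bf_act2 R G1 G2 k) (@bf_act1 R G1 G2 k).

Lemma butterfly_flip_invertible : bf_invertible butterfly_flip.
Proof. exact: (bf_exact k). Qed.

End Invertible.
End Butterfly.

Lemma Tspace_transport (R : realType) (f f' : lieTvsType R) (W W' : tvsType R)
    (V : set W) (V' : set W') (phi : f' -> f) (psi : W -> W') b :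
  lie_hom phi -> lin_cont psi -> (forall y, V y -> V' (psi y)) ->
  Tspace f V b -> Tspace f' V' (fun x y => psi (b (phi x) (phi y))).
Proof.
move=> [hphi phiL] hpsi VV' [b1 b2 b3]; split.
- exact/(bilin_cont_post hpsi)/bilin_cont_pre.
- by move=> x y; exact/VV'/b2.
- by move=> x y z; rewrite !phiL -(b3 (phi x)) (lcD hpsi).
Qed.

Lemma affine_set_bij (R : realType) (D : lmodType R) (V : set D)
    (E : Type) (S : set E) (act : E -> D -> E) x :
  affine_over V S act -> S x -> set_bij V S (act x).
Proof.
move=> [[V0 VD] act1 [act2 act3] act4 act5] Sx.
split.
- by move=> v Vv; exact: act1.
- move=> v w /set_mem Vv /set_mem Vw e.
  have Vd : V (w - v) by rewrite addrC -scaleN1r; exact: VD.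
  apply/esym/eqP; rewrite -subr_eq0; apply/eqP.
  apply: (act4 (act x v)) => //; first exact: act1.
  by rewrite -act3// addrC subrK e.
- by move=> y Sy; have [v Vv <-] := act5 x y Sx Sy; exists v.
Qed.

Section WeakEquivalence.
Context {R : realType} {G1 G2 : crossedModule R}.
Context (s1 : cm_f G1 -> cm_g G1) (s2 : cm_f G2 -> cm_g G2).
Context (sep2 : smoothly_separable G2).
Context (hs1 : cm_section s1) (hs2 : cm_section s2).

Lemma separable_half_splitting (G : crossedModule R) :
  smoothly_separable G -> exists u : cm_g G -> cm_h G, half_splitting u.
Proof. by move=> [_ _ [u [hu tu _]]]; exists u. Qed.

Lemma weak_adj_at : weakly_equivalent G1 G2 ->
  Adj_at G1 s1 !=set0 -> Adj_at G2 s2 !=set0.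
Proof.
move=> [k inv] [eta he]; have [u2 hu2] := separable_half_splitting sep2.
have [q2 [hq2 rq2]] := bf_split_inv inv hu2 hs1.
have [eta2 he2] := bf_adj inv hq2 rq2 hs1 he.
by have [eta' he'] := adj_adapt hu2 hs2 he2; exists eta'.
Qed.

Lemma weakly_equivalent_sym :
  weakly_equivalent G1 G2 -> weakly_equivalent G2 G1.
Proof.
move=> [k inv]; have [u2 hu2] := separable_half_splitting sep2.
have split2 := bf_split_inv inv hu2 hs1.
by exists (butterfly_flip inv split2); exact: butterfly_flip_invertible.
Qed.

Lemma weak_Tspace_bij : weakly_equivalent G1 G2 ->
  exists L, set_bij (Tspace (cm_f G1) (cm_a G1)) (Tspace (cm_f G2) (cm_a G2)) L.
Proof.
move=> [k inv]; have [u2 hu2] := separable_half_splitting sep2.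
have split2 := bf_split_inv inv hu2 hs1.
pose k' := butterfly_flip inv split2.
have inv' : bf_invertible k' by exact: butterfly_flip_invertible.
have [phi [hphi phiE]] := bf_quotient_map inv.
have [phi' [hphi' phiE']] := bf_quotient_map inv'.
have [psi [hpsi apsi psiE]] := bf_kernel_map k.
have [psi' [hpsi' apsi' psiE']] := bf_kernel_map k'.
have phiK z : phi (phi' z) = z.
  rewrite -(cm_p_surj z); have [q [_ rq]] := bf_split k.
  by rewrite -(rq (repr z)) [phi' _]phiE' phiE.
have phiK' z : phi' (phi z) = z.
  rewrite -(cm_p_surj z); have [q [_ rq]] := split2.
  by rewrite -(rq (repr z)) phiE [LHS]phiE'.
have psiK y : cm_a G1 y -> psi' (psi y) = y.
  move=> ay; apply: (bf_i1_inj inv).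
  by rewrite [LHS]psiE'; [exact: psiE|exact: apsi].
have psiK' y : cm_a G2 y -> psi (psi' y) = y.
  move=> ay; apply: (@bf_i2_inj _ _ _ k).
  by rewrite psiE; [exact: psiE'|exact: apsi'].
exists (fun b x y => psi (b (phi x) (phi y))); split.
- by move=> b; exact: Tspace_transport.
- move=> b c /set_mem[_ b2 _] /set_mem[_ c2 _] e.
  apply/funext => x; apply/funext => y.
  have := congr1 (fun d => psi' (d (phi' x) (phi' y))) e.
  by rewrite !phiK !psiK.
- move=> b hb; exists (fun x y => psi' (b (phi' x) (phi' y))).
    exact: (Tspace_transport hphi' hpsi' apsi' hb).
  have [_ b2 _] := hb.
  by apply/funext => x; apply/funext => y; rewrite !phiK' psiK'.
Qed.

End WeakEquivalence.

Theorem theorem1p2 (R : realType) (G : crossedModule R)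
    (sepG : smoothly_separable G) (centG : central G)
    (s : cm_f G -> cm_g G) (hs : cm_section s) :
  [/\ (Adj G !=set0 <-> Adj_at G s !=set0) /\
      (Adj_at G s !=set0 <->
        exists2 B, Sym2_ad (cm_f G) (cm_a G) B & class3 (cm_a G) (cw B) = KL G),
      affine_over (Tspace (cm_f G) setT) (Adj G) (@adj_shift R G) /\
      affine_over (Tspace (cm_f G) (cm_a G)) (Adj_at G s) (@adj_shift R G),
      [/\ forall eta, Adj_at G s eta ->
            [/\ Sym2_ad (cm_f G) (cm_a G) (KL_adj eta),
                forall X Y, 2^-1 *: (eta X Y + eta Y X)
                              = - KL_adj eta (cm_p X) (cm_p Y) &
                class3 (cm_a G) (cw (KL_adj eta)) = KL G],
          Alt2_cl (cm_f G) (cm_a G) `<=` Tspace (cm_f G) (cm_a G) &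
          forall B, Sym2_ad (cm_f G) (cm_a G) B ->
            let fibre := [set eta | Adj_at G s eta /\ KL_adj eta = B] in
            (class3 (cm_a G) (cw B) = KL G ->
              fibre !=set0 /\
              affine_over (Alt2_cl (cm_f G) (cm_a G)) fibre (@adj_shift R G)) /\
            (class3 (cm_a G) (cw B) <> KL G -> fibre = set0)] &
      forall (G' : crossedModule R) (s' : cm_f G' -> cm_g G'),
        smoothly_separable G' -> central G' -> cm_section s' ->
        weakly_equivalent G G' ->
        exists F, set_bij (Adj_at G s) (Adj_at G' s') F].
Proof.
have [u hu] := separable_half_splitting sepG.
have a0 := @cm_a0 R G; have aD := @cm_a_linear R G.
have AltT w : Alt2_cl (cm_f G) (cm_a G) w -> Tspace (cm_f G) (cm_a G) w.
  by move=> [Aw dw]; exact/(Tspace_Alt2 Aw).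
split.
- split; split.
  + by move=> [eta he]; have [eta' he'] := adj_adapt hu hs he; exists eta'.
  + by move=> [eta [he _]]; exists eta.
  + move=> [eta he]; exists (KL_adj eta); first by case: (KL_adj_spec hs he).
    exact: (cw_KL_adj centG hu hs he).
  + move=> [B hB cwB]; have [eta [he _]] := KL_adj_surj centG hu hs hB cwB.
    by exists eta.
- by split; [exact: affine_adj hs|exact: affine_adj_at].
- split=> [eta he|//|B hB fibre].
    have [hB eB] := KL_adj_spec hs he; split=> //.
    exact: (cw_KL_adj centG hu hs he).
  split=> [cwB|ncwB]; last first.
    apply/seteqP; split=> // eta [he etaB]; apply: ncwB.
    by rewrite -etaB; exact: (cw_KL_adj centG hu hs he).
  have [eta0 he0] := KL_adj_surj centG hu hs hB cwB.
  split; first by exists eta0.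
  split.
  + by split=> [|a v w]; [exact: Alt2_cl0|exact: Alt2_cl_linear].
  + move=> eta b [he etaB] hb; split; first exact: (adj_at_shift he (AltT _ hb)).
    by rewrite (KL_adj_shift_eq hs he (AltT _ hb)).2.
  + by split=> *; [exact: adj_shift0|exact: adj_shiftD].
  + by move=> eta b _ _ e; apply: (@adj_shift_inj R G eta); rewrite e adj_shift0.
  + move=> eta eta' [he etaB] [he' etaB'].
    have [b hb e] := adj_at_diff hs he he'; exists b => //.
    by apply/(KL_adj_shift_eq hs he hb); rewrite -e etaB'.
- move=> G' s' sep' _ hs' eqv; have eqv' := weakly_equivalent_sym sep' hs eqv.
  have [[eta he]|ne] := pselect (Adj_at G s !=set0).
    have [eta' he'] := weak_adj_at sep' hs hs' eqv (ex_intro _ eta he).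
    have [L bijL] := weak_Tspace_bij sep' hs eqv.
    have bij := affine_set_bij (affine_adj_at hs) he.
    have bij' := affine_set_bij (affine_adj_at hs') he'.
    eexists; apply: set_bij_comp bij'; apply: set_bij_comp bijL.
    exact: (bijpinv_bij (fun=> 0) bij).
  have -> : Adj_at G s = set0 by apply/nonemptyPn.
  have -> : Adj_at G' s' = set0.
    by apply/nonemptyPn => /(weak_adj_at sepG hs' hs eqv').
  exists (fun=> 0); exact: set_bij00.
Qed.
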